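(* There is an absolute constant $K>0$ such that the following holds. Let $U_{AB}$ be a unitary acting on $n$ qubits in total (split between Alice's input system $A$ and Bob's input system $B$) which admits a Clifford$+T$ decomposition of $T$-depth $d$. Then \[ E(U_{AB}) \le O\big((Kn)^d\big), \] where $E(U_{AB})$ denotes the number of EPR pairs needed to implement $U_{AB}$ as a non-local quantum computation.
   Context: A non-local quantum computation (NLQC) with inputs $A$ (held by Alice) and $B$ (held by Bob) and outputs $A$ (Alice) and $B$ (Bob) is a channel of the form $\mathcal{N}_{AB\to AB}(\cdot)=(\mathcal{W}_{K_aM_a\to A}\otimes\mathcal{W}'_{K_bM_b\to B})\circ(\mathcal{V}_{AL\to K_aM_b}\otimes\mathcal{V}'_{RB\to M_aK_b})(\cdot\otimes\Psi_{LR})$, where $\Psi_{LR}$ is a shared resource state with $L$ held by Alice and $R$ by Bob and $\mathcal{V},\mathcal{V}',\mathcal{W},\mathcal{W}'$ are quantum channels: each party acts locally, they exchange one simultaneous round of quantum communication ($M_b$ sent Alice$\to$Bob, $M_a$ sent Bob$\to$Alice), and act locally again. $E(U)$ is the minimal number of EPR pairs (maximally entangled qubit pairs) forming the resource state of an NLQC whose channel equals $\rho\mapsto U\rho U^\dagger$. A Clifford$+T$ decomposition of $T$-depth $d$ is a factorization $U=C_{d+1}\bar T_d C_d\bar T_{d-1}\cdots \bar T_1 C_1$ where each $C_i$ is a Clifford unitary on all $n$ qubits and each $\bar T_i$ is a layer consisting of single-qubit $T=\mathrm{diag}(1,e^{i\pi/4})$ gates on some subset of the qubits.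
   Formalization: The T-depth d is required to be at least 1: at d = 0 the bound O(1) fails, since CZ gates across the cut on n qubits need at least n/8 EPR pairs. Matrix entries are algebraic numbers, which covers all Clifford+T unitaries up to a global phase. *)

(* Defs.v *)
(* Complex amplitudes live in algC (algebraic complex numbers),
   which contains all amplitudes needed (i, sqrt 2, e^{i pi/4}). *)
From mathcomp Require Import all_boot all_order all_algebra.
From mathcomp Require Import algC.
Set Implicit Arguments. Unset Strict Implicit. Unset Printing Implicit Defensive.
Import Order.TTheory GRing.Theory Num.Theory.
Local Open Scope ring_scope.

(* A Hilbert space is C^I for a finite type I of basis labels.
   [Op I J] is a linear map C^I -> C^J, given by its matrix: [X j i] = <j|X|i>. *)
Definition Op (I J : finType) := J -> I -> algC.

Definition mulop (I J K : finType) (X : Op J K) (Y : Op I J) : Op I K :=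
  fun k i => \sum_(j : J) X k j * Y j i.

Definition adj (I J : finType) (X : Op I J) : Op J I := fun i j => (X j i)^*.

Definition idop (I : finType) : Op I I := fun j i => (j == i)%:R.

Definition tens_op (I J I' J' : finType) (X : Op I J) (Y : Op I' J') : Op (I * I')%type (J * J')%type :=
  fun j i => X j.1 i.1 * Y j.2 i.2.

(* relabelling of tensor factors (conjugation by the permutation unitary of sigma) *)
Definition reindex (I J : finType) (sigma : J -> I) (X : Op I I) : Op J J :=
  fun j j' => X (sigma j) (sigma j').

Definition unitary (I : finType) (U : Op I I) : Prop :=
  forall i i', mulop (adj U) U i i' = @idop I i i' /\ mulop U (adj U) i i' = @idop I i i'.

Record channel (I J : finType) : Type := Channel {
  kidx : finType;
  kop : kidx -> Op I J;
  kop_tp : forall i i', \sum_(k : kidx) mulop (adj (kop k)) (kop k) i i' = @idop I i i'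
}.

Definition apply2 (I1 J1 I2 J2 : finType) (Phi : channel I1 J1) (Phi' : channel I2 J2)
  (X : Op (I1 * I2)%type (I1 * I2)%type) : Op (J1 * J2)%type (J1 * J2)%type :=
  fun j j' => \sum_(k : kidx Phi) \sum_(k' : kidx Phi')
    let Kr := tens_op (kop k) (kop k') in mulop (mulop Kr X) (adj Kr) j j'.

(* computational basis of n qubits *)
Definition Q (n : nat) : finType := {ffun 'I_n -> bool}.

(* Resource state of m EPR pairs |Phi+>^{(x) m}, on L (x) R with L = R = m qubits *)
Definition epr (m : nat) : Op (Q m * Q m)%type (Q m * Q m)%type :=
  fun p p' => (p.1 == p.2)%:R * (p'.1 == p'.2)%:R / (2 ^ m)%:R.

(* N(rho) = (W_{KaMa->A} (x) W'_{MbKb->B}) o (V_{AL->KaMb} (x) V'_{RB->MaKb}) (rho (x) Psi_LR) *)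
Definition nlqc_map (A B : finType) (m : nat) (Ka Ma Mb Kb : finType)
  (V : channel (A * Q m)%type (Ka * Mb)%type) (V' : channel (Q m * B)%type (Ma * Kb)%type)
  (W : channel (Ka * Ma)%type A) (W' : channel (Mb * Kb)%type B)
  (rho : Op (A * B)%type (A * B)%type) : Op (A * B)%type (A * B)%type :=
  let X0 := tens_op rho (@epr m) in
  let X1 := reindex (fun p : (A * Q m)%type * (Q m * B)%type =>
                       ((p.1.1, p.2.2), (p.1.2, p.2.1))) X0 in
  let X2 := apply2 V V' X1 in
  let X3 := reindex (fun p : (Ka * Ma)%type * (Mb * Kb)%type =>
                       ((p.1.1, p.2.1), (p.1.2, p.2.2))) X2 in
  apply2 W W' X3.

Definition nlqc_implements (A B : finType) (U : Op (A * B)%type (A * B)%type) (m : nat) : Prop :=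
  exists (Ka Ma Mb Kb : finType)
         (V : channel (A * Q m)%type (Ka * Mb)%type) (V' : channel (Q m * B)%type (Ma * Kb)%type)
         (W : channel (Ka * Ma)%type A) (W' : channel (Mb * Kb)%type B),
    forall (rho : Op (A * B)%type (A * B)%type) (j j' : A * B),
      nlqc_map V V' W W' rho j j' = mulop (mulop U rho) (adj U) j j'.

(* E(U) <= k : the minimal number of EPR pairs is at most k *)
Definition E_le (A B : finType) (U : Op (A * B)%type (A * B)%type) (k : algC) : Prop :=
  exists m : nat, m%:R <= k /\ nlqc_implements U m.

(* Pauli string X^x Z^z :  |y> |-> (-1)^{z.y} |y xor x> *)
Definition pauli (n : nat) (x z : Q n) : Op (Q n) (Q n) :=
  fun j i => (j == [ffun k => xorb (i k) (x k)] :> Q n)%:R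
             * (-1) ^+ #|[set k | z k && i k]|.

(* Pauli group element i^c X^x Z^z (Y = i X Z, so these are all of them) *)
Definition pauli_elt (n : nat) (c : nat) (x z : Q n) : Op (Q n) (Q n) :=
  fun j i => 'i ^+ c * pauli x z j i.

Definition clifford (n : nat) (C : Op (Q n) (Q n)) : Prop :=
  unitary C /\
  forall (c : nat) (x z : Q n), exists (c' : nat) (x' z' : Q n),
    forall j i, mulop (mulop C (pauli_elt c x z)) (adj C) j i = pauli_elt c' x' z' j i.

(* T = diag(1, e^{i pi/4}),  e^{i pi/4} = (1 + i)/sqrt 2 *)
Definition omega8 : algC := (1 + 'i) / sqrtC 2.

Definition tlayer (n : nat) (S : {set 'I_n}) : Op (Q n) (Q n) :=
  fun j i => (j == i)%:R * omega8 ^+ #|[set k in S | i k]|.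

Fixpoint ct_prod (n : nat) (Cs : nat -> Op (Q n) (Q n)) (Ts : nat -> {set 'I_n}) (k : nat)
  : Op (Q n) (Q n) :=
  match k with
  | 0 => Cs 0
  | k'.+1 => mulop (mulop (Cs k) (tlayer (Ts k'))) (ct_prod Cs Ts k')
  end.

(* U = C_{d+1} Tbar_d C_d ... Tbar_1 C_1 (here indexed 0..d) *)
Definition has_CT_decomp (n : nat) (U : Op (Q n) (Q n)) (d : nat) : Prop :=
  exists (Cs : nat -> Op (Q n) (Q n)) (Ts : nat -> {set 'I_n}),
    (forall k, (k <= d)%N -> clifford (Cs k)) /\
    forall j i, U j i = ct_prod Cs Ts d j i.

Definition qjoin (a b : nat) (xa : Q a) (xb : Q b) : Q (a + b) :=
  [ffun k => match split k with inl i => xa i | inr i => xb i end].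

Definition split_op (a b : nat) (U : Op (Q (a + b)) (Q (a + b))) : Op (Q a * Q b)%type (Q a * Q b)%type :=
  fun j i => U (qjoin j.1 j.2) (qjoin i.1 i.2).

(* Main.v *)
Require Import Defs.
From mathcomp Require Import all_boot all_order all_algebra.
From mathcomp Require Import algC.
From mathcomp Require Import ring zify.
Set Implicit Arguments. Unset Strict Implicit. Unset Printing Implicit Defensive.
Import Order.TTheory GRing.Theory Num.Theory.
Local Open Scope ring_scope.

(** Bob teleports his qubits to Alice, who then holds the whole input up to a
    Pauli error X^x Z^z whose bits depend on the measurement outcomes of both
    parties.  Cliffords keep the error Pauli and act linearly on its bits; a
    layer of T gates turns an X error on a wire into an additional S gate,
    which has to be undone although no single party knows whether it is there.

    Every error bit f is kept together with a straight-line linear program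
    over F_2: a triangular system p = M p + v, each row of which is known to
    one of the parties, one of whose unknowns is f.  To undo S^f on a wire with
    bit y, the parties use one EPR pair per row: the owner of row i measures
    the parity r_i + (M r + v y)_i, which forces r = p y + q for some noise q,
    Alice applies a phase to the wire carrying f y + q_out, and all other bits
    are erased by X-basis measurements.  This leaves only a Z error
    h = sum_i s_i p_i + f q_out.  Evaluating the program in reverse mode makes
    f q_out linear in the noise, so h has a program only a constant factor
    longer.  Summation over the 2n error bits in a Clifford costs a factor
    O(n) per layer, whence (Kn)^d EPR pairs.  At the end Alice returns Bob's
    qubits in the single communication round, and both parties undo the Pauli
    error, which they know once the outcomes are exchanged. *)

(** * Two-party linear programs over F_2 *)

Lemma addbool2 (x : bool) : x + x = 0.
Proof. by case: x. Qed.

Lemma sum_unit (V : nmodType) (F : unit -> V) : \sum_u F u = F tt.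
Proof. by rewrite (big_pred1 tt) // => -[]. Qed.

Lemma sum_pick (I : finType) (o : I) (F : I -> bool) :
  \sum_j (j == o) * F j = F o.
Proof.
rewrite (bigD1 o) //= eqxx mul1r big1 ?addr0 // => j /negPf->.
by rewrite mul0r.
Qed.

Definition solves (I : finType) (M : I -> I -> bool) (b x : I -> bool) :=
  forall i, x i = \sum_j M i j * x j + b i.

Definition triangular (I : finType) (rk : I -> nat) (M : I -> I -> bool) :=
  forall i j, M i j -> (rk j < rk i)%N.

Section Triangular.
Variables (I : finType) (rk : I -> nat) (M : I -> I -> bool).
Hypothesis triM : triangular rk M.

Lemma solves_unique b x x' : solves M b x -> solves M b x' -> x =1 x'.
Proof.
move=> sx sx' i; have [n] := ubnP (rk i).
elim: n i => // n IHn i; rewrite ltnS => le_i.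
rewrite sx sx'; congr (_ + _); apply: eq_bigr => j _.
case Mij: (M i j); last by rewrite !mul0r.
by rewrite IHn // (leq_trans (triM Mij)).
Qed.

Definition solution (b : I -> bool) : {ffun I -> bool} :=
  odflt [ffun=> false] [pick x : {ffun I -> bool}
    | [forall i, x i == \sum_j M i j * x j + b i]].

Lemma solutionP b : solves M b (solution b).
Proof.
rewrite /solution; case: pickP => [x /forallP sx | no_sol] i /=.
  exact/eqP.
(* Over F_2 the system reads x + M x = b. Uniqueness makes this map injective on a finite set, hence
   onto, so the default value in [solution] is never taken. *)
pose F (x : {ffun I -> bool}) : {ffun I -> bool} :=
  [ffun k => x k + \sum_j M k j * x j].
have Finj : injective F.
  move=> x x' eqF; apply/ffunP.
  have sol z : solves M (F z) z.
    by move=> k; rewrite ffunE addrA [_ + z k]addrC -addrA addbool2 addr0.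
  by apply: (solves_unique (sol x)); rewrite eqF.
have [G FK GK] := injF_bij Finj.
have/forallP[] := no_sol (G [ffun k => b k]) => k.
have/ffunP/(_ k) := GK [ffun k => b k]; rewrite !ffunE => <-.
by rewrite addrA [_ + G _ k]addrC -addrA addbool2 addr0.
Qed.

End Triangular.

(** Transposing reverses every dependency, so ranks are reversed by subtracting them from the
    largest one. *)
Lemma triangular_trmx (I : finType) (rk : I -> nat) (M : I -> I -> bool) :
  triangular rk M ->
  triangular (fun i => \max_j rk j - rk i)%N (fun i j => M j i).
Proof.
move=> triM i j /triM lt_ij.
by have := leq_bigmax (F := rk) i; have := leq_bigmax (F := rk) j; lia.
Qed.

(* Row [i] belongs to Alice if [own i] and to Bob otherwise; only Alice holds
   the input wire, hence [inp] depends on [al] alone. *)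
Record linsys (al be : finType) := LinSys {
  idx : finType;
  own : pred idx;
  rowA : al -> idx -> idx -> bool;
  rowB : be -> idx -> idx -> bool;
  inp : al -> idx -> bool;
  rnk : idx -> nat;
  out : idx;
  wire : al -> be -> idx -> bool;
  coef := (fun a b i j => if own i then rowA a i j else rowB b i j);
  rowAP : forall a i j, own i -> rowA a i j -> (rnk j < rnk i)%N;
  rowBP : forall b i j, ~~ own i -> rowB b i j -> (rnk j < rnk i)%N;
  wireP : forall a b, solves (coef a b) (fun i => own i && inp a i) (wire a b)
}.
Arguments own {al be} l _.
Arguments rowA {al be} l _ _ _.
Arguments rowB {al be} l _ _ _.
Arguments inp {al be} l _ _.
Arguments rnk {al be} l _.
Arguments wire {al be} l _ _ _.
Arguments coef {al be} l _ _ _ _.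

Lemma coefP (al be : finType) (S : linsys al be) a b :
  triangular (rnk S) (coef S a b).
Proof.
move=> i j; rewrite /coef; have [oi|oi] := boolP (own S i).
  exact: rowAP.
exact: rowBP.
Qed.

(** The cost measure: the number of rows bounds the EPR pairs spent on undoing an S gate controlled
    by [f]. *)
Definition lin (al be : finType) (N : nat) (f : al -> be -> bool) :=
  exists S : linsys al be, (#|idx S| <= N)%N /\
    forall a b, f a b = wire S a b (out S).

Section Lin.
Variables al be : finType.
Implicit Types f g : al -> be -> bool.

Lemma lin_leq N N' f : (N <= N')%N -> lin N f -> lin N' f.
Proof. by move=> leN [S [cS fS]]; exists S; split=> //; apply: leq_trans leN. Qed.

Lemma lin_ext N f g : (forall a b, f a b = g a b) -> lin N f -> lin N g.
Proof. by move=> efg [S [cS fS]]; exists S; split=> // a b; rewrite -efg. Qed.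

Lemma lin_false N : (0 < N)%N -> @lin al be N (fun _ _ => false).
Proof.
move=> N0.
unshelve eexists (@LinSys al be unit xpredT (fun _ _ _ => false)
  (fun _ _ _ => false) (fun _ _ => false) (fun=> 0%N) tt (fun _ _ _ => false)
  _ _ _) => //=.
- by move=> a b i; rewrite big1.
- by split=> //; rewrite card_unit.
Qed.

(** Bob's rows have no inhomogeneous term, so a row of Alice supplies the constant 1 and Bob's row
    multiplies it by [g b]; hence two rows. *)
Lemma lin_bob N (g : be -> bool) : (1 < N)%N -> @lin al be N (fun _ => g).
Proof.
move=> N1.
unshelve eexists (@LinSys al be bool id (fun _ _ _ => false)
  (fun b _ j => g b && j) (fun _ _ => true) (fun i => ~~ i) false
  (fun _ b i => i || g b) _ _ _) => //=.
- by move=> b [] [] //=; rewrite andbF.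
- by move=> a b [] /=; rewrite big_bool /=; case: (g b).
- by split=> //; rewrite card_bool.
Qed.

(** The two systems sit side by side; one more row, assigned to Alice and with constant
    coefficients, adds their outputs. *)
Lemma lin_add N1 N2 f g : lin N1 f -> lin N2 g ->
  lin (N1 + N2).+1 (fun a b => f a b + g a b).
Proof.
move=> [S [cS fS]] [T [cT gT]].
pose J := (idx S + idx T + unit)%type.
pose mk (m1 : idx S -> idx S -> bool) (m2 : idx T -> idx T -> bool)
   (i j : J) : bool := match i, j with
  | inl (inl i), inl (inl j) => m1 i j
  | inl (inr i), inl (inr j) => m2 i j
  | inr _, inl (inl j) => j == out S
  | inr _, inl (inr j) => j == out T
  | _, _ => false end.
pose B := (maxn (rnk S (out S)) (rnk T (out T))).+1.
unshelve eexists (@LinSys al be J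
  (fun i => match i with inl (inl i) => own S i | inl (inr i) => own T i
            | inr _ => true end)
  (fun a => mk (rowA S a) (rowA T a))
  (fun b => mk (rowB S b) (rowB T b))
  (fun a i => match i with inl (inl i) => inp S a i
     | inl (inr i) => inp T a i | inr _ => false end)
  (fun i => match i with inl (inl i) => rnk S i | inl (inr i) => rnk T i
            | inr _ => B end)
  (inr tt)
  (fun a b i => match i with inl (inl i) => wire S a b i
     | inl (inr i) => wire T a b i | inr _ => f a b + g a b end) _ _ _) => /=.
- move=> a [[i|i]|i] [[j|j]|j] //=.
  + exact: rowAP.
  + exact: rowAP.
  + by move=> _ /eqP->; rewrite /B; lia.
  + by move=> _ /eqP->; rewrite /B; lia.
- move=> b [[i|i]|i] [[j|j]|j] //=; exact: rowBP.
- move=> a b i; rewrite !big_sumType /= sum_unit.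
  case: i => [[i|i]|i] /=.
  + rewrite [X in _ + X + _ + _]big1 ?addr0 => [|j _]; last by rewrite if_same mul0r.
    by rewrite if_same mul0r addr0 [LHS]wireP.
  + rewrite [X in X + _ + _ + _]big1 ?add0r => [|j _]; last by rewrite if_same mul0r.
    by rewrite if_same mul0r addr0 [LHS]wireP.
  + by rewrite !sum_pick mul0r !addr0 fS gT.
- by split=> //; rewrite !card_sum card_unit addn1 ltnS leq_add.
Qed.

Lemma lin_sum (T : Type) (s : seq T) (c : T -> bool) N
  (F : T -> al -> be -> bool) :
  (forall t, lin N (F t)) ->
  lin (size s * N.+1).+1 (fun a b => \sum_(t <- s) c t * F t a b).
Proof.
move=> linF; elim: s => [|t s IHs] /=.
  by apply: lin_ext (lin_false _) => // a b; rewrite big_nil.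
have [ct|ct] := boolP (c t).
  apply: lin_ext (lin_leq _ (lin_add (linF t) IHs)) => [a b|].
    by rewrite big_cons ct mul1r.
  by rewrite mulSn; lia.
apply: lin_ext (lin_leq _ IHs) => [a b|]; last by rewrite mulSn; lia.
by rewrite big_cons (negPf ct) mul0r add0r.
Qed.

End Lin.

(** Programs survive later rounds this way: the enlarged outcome types project onto the earlier
    ones. *)
Lemma lin_pull (al be al' be' : finType) (h : al' -> al) (k : be' -> be) N
  (f : al -> be -> bool) :
  lin N f -> lin N (fun a b => f (h a) (k b)).
Proof.
move=> [S [cS fS]].
by exists (@LinSys al' be' (idx S) (own S) (fun a => rowA S (h a))
  (fun b => rowB S (k b)) (fun a => inp S (h a)) (rnk S) (out S)
  (fun a b => wire S (h a) (k b)) (fun a => @rowAP _ _ S (h a)) (fun b => @rowBP _ _ S (k b))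
  (fun a b => @wireP _ _ S (h a) (k b))); split=> // a b; rewrite fS.
Qed.

(** * The Z error left behind by one gadget *)

Section GadgetError.
Variables (al be : finType) (S : linsys al be).
Let I := idx S.

(* Each party announces one bit per row: the owner of row [i] announces the
   additive noise of that row, the other party the sign of an X-basis
   measurement. *)
Definition noise (oA oB : {ffun I -> bool}) (i : I) : bool :=
  if own S i then oA i else oB i.
Definition xsign (oA oB : {ffun I -> bool}) (i : I) : bool :=
  if own S i then oB i else oA i.

Definition offset a b oA oB := solution (coef S a b) (noise oA oB).

Definition zerr a b oA oB : bool :=
  \sum_i xsign oA oB i * wire S a b i
  + wire S a b (out S) * offset a b oA oB (out S).

(** The back-propagated output: entry [i] is the bit on the output wire times the sensitivity of
    [offset] at [out S] to the noise of row [i]. *)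
Definition adjval a b :=
  solution (fun i j => coef S a b j i)
    (fun i => (i == out S) * wire S a b (out S)).

(* Reverse-mode evaluation makes the product of two outputs linear. *)
Lemma offset_adjval a b oA oB :
  wire S a b (out S) * offset a b oA oB (out S)
  = \sum_i noise oA oB i * adjval a b i.
Proof.
have q := solutionP (@coefP _ _ S a b) (noise oA oB).
have w := solutionP (triangular_trmx (@coefP _ _ S a b))
  (fun i => (i == out S) * wire S a b (out S)).
rewrite -/(offset a b oA oB) -/(adjval a b) in q w.
have -> : \sum_i noise oA oB i * adjval a b i
   = \sum_i offset a b oA oB i * adjval a b i
   + \sum_i \sum_j coef S a b i j * offset a b oA oB j * adjval a b i.
  rewrite -big_split; apply: eq_bigr => i _ /=.
  rewrite [in RHS]q -mulr_suml -mulrDl; congr (_ * _).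
  by rewrite addrAC addbool2 add0r.
rewrite exchange_big -big_split /=.
have step j : offset a b oA oB j * adjval a b j
   + \sum_i coef S a b i j * offset a b oA oB j * adjval a b i
   = (j == out S) * (wire S a b (out S) * offset a b oA oB j).
  rewrite w mulrDr mulr_sumr addrAC -big_split /= big1 ?add0r => [|i _].
    by rewrite mulrCA [offset _ _ _ _ _ * _]mulrC.
  by rewrite mulrA [offset _ _ _ _ _ * _]mulrC addbool2.
by rewrite (eq_bigr _ (fun j _ => step j)) sum_pick.
Qed.

(** Rows of the transposed system mix entries owned by both parties, so each adjoint value is split
    into a share computed by Alice and one computed by Bob; the error itself is split likewise. This
    gives one forward and two adjoint rows per row of [S], two partial sums and a final sum. *)
Lemma lin_zerr :
  @lin (al * {ffun I -> bool})%type (be * {ffun I -> bool})%type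
    (3 * #|I| + 3) (fun a b => zerr a.1 b.1 a.2 b.2).
Proof.
pose J := (I + (I + I) + (unit + unit) + unit)%type.
pose mk (fwd adj : I -> I -> bool) (st p w : I -> bool) (i j : J) : bool :=
  match i, j with
  | inl (inl (inl i)), inl (inl (inl j)) => fwd i j
  | inl (inl (inr (inl i))), inl (inl (inl j)) => (i == out S) && (j == out S)
  | inl (inl (inr (inl i))), inl (inl (inr (inl j)))
  | inl (inl (inr (inl i))), inl (inl (inr (inr j)))
  | inl (inl (inr (inr i))), inl (inl (inr (inl j)))
  | inl (inl (inr (inr i))), inl (inl (inr (inr j))) => adj i j
  | inl (inr _), inl (inl (inl j)) => p j
  | inl (inr _), inl (inl (inr (inl j)))
  | inl (inr _), inl (inl (inr (inr j))) => w j
  | inr _, inl (inr _) => true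
  | _, _ => false end.
pose B := (\max_j rnk S j)%N.
pose wA a b i := \sum_j (own S j && rowA S a j i) * adjval a b j
   + (i == out S) * wire S a b (out S).
pose wB a b i := \sum_j (~~ own S j && rowB S b j i) * adjval a b j.
pose hA a b (oA : {ffun I -> bool}) := \sum_j (~~ own S j && oA j) * wire S a b j
   + \sum_j (own S j && oA j) * adjval a b j.
pose hB a b (oB : {ffun I -> bool}) := \sum_j (own S j && oB j) * wire S a b j
   + \sum_j (~~ own S j && oB j) * adjval a b j.
have wE a b i : wA a b i + wB a b i = adjval a b i.
  rewrite /wA /wB addrAC -big_split /=.
  rewrite [RHS](solutionP (triangular_trmx (@coefP _ _ S a b))).
  congr (_ + _); apply: eq_bigr => j _.
  by rewrite -mulrDl /coef; case: (own S j); rewrite /= ?addr0 ?add0r.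
have wE2 a b (c : I -> bool) : \sum_j c j * wA a b j + \sum_j c j * wB a b j
   = \sum_j c j * adjval a b j.
  rewrite -big_split; apply: eq_bigr => j _; rewrite -(wE a b j).
  by rewrite [in RHS]mulrDr.
have rB j : (rnk S j <= B)%N by exact: leq_bigmax.
clearbody B.
unshelve eexists (@LinSys (al * {ffun I -> bool})%type
  (be * {ffun I -> bool})%type J
  (fun i => match i with
    | inl (inl (inl i)) => own S i | inl (inl (inr (inl i))) => true
    | inl (inl (inr (inr i))) => false | inl (inr (inl _)) => true
    | inl (inr (inr _)) => false | inr _ => true end)
  (fun a => mk (rowA S a.1) (fun i j => own S j && rowA S a.1 j i) (fun=> true)
     (fun j => ~~ own S j && a.2 j) (fun j => own S j && a.2 j))
  (fun b => mk (rowB S b.1) (fun i j => ~~ own S j && rowB S b.1 j i)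
     (fun=> true) (fun j => own S j && b.2 j) (fun j => ~~ own S j && b.2 j))
  (fun a i => match i with inl (inl (inl i)) => inp S a.1 i | _ => false end)
  (* Since [rnk S] is at most [B], the adjoint ranks lie above all forward ranks and run in the
     opposite order. *)
  (fun i => match i with
    | inl (inl (inl i)) => rnk S i | inl (inl (inr (inl i)))
    | inl (inl (inr (inr i))) => (2 * B).+1 - rnk S i
    | inl (inr _) => (2 * B).+2 | inr _ => (2 * B).+3 end)%N
  (inr tt)
  (fun a b i => match i with
    | inl (inl (inl i)) => wire S a.1 b.1 i
    | inl (inl (inr (inl i))) => wA a.1 b.1 i
    | inl (inl (inr (inr i))) => wB a.1 b.1 i
    | inl (inr (inl _)) => hA a.1 b.1 a.2
    | inl (inr (inr _)) => hB a.1 b.1 b.2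
    | inr _ => zerr a.1 b.1 a.2 b.2 end) _ _ _) => /=.
- move=> [a oA] i j /=.
  case: i => [[[i|[i|i]]|[i|i]]|i]; case: j => [[[j|[j|j]]|[j|j]]|j] //=.
  + exact: rowAP.
  + by move=> _ /andP[_ /eqP->]; have := rB i; have := rB (out S); lia.
  1-2: move=> _ /andP[oj Mij]; have := rB i; have := rB j;
       have := rowAP oj Mij; lia.
  all: try by have := rB j; lia.
- move=> [b oB] i j /=.
  case: i => [[[i|[i|i]]|[i|i]]|i]; case: j => [[[j|[j|j]]|[j|j]]|j] //=.
  + exact: rowBP.
  1-2: move=> _ /andP[oj Mij]; have := rB i; have := rB j;
       have := rowBP oj Mij; lia.
  all: try by have := rB j; lia.
- move=> [a oA] [b oB] i /=; rewrite !big_sumType /= !sum_unit.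
  case: i => [[[i|[i|i]]|[i|i]]|i] /=.
  + rewrite !if_same !mul0r !addr0 [LHS]wireP; congr (_ + _).
    rewrite [X in _ + (X + _)]big1 ?add0r => [|j _]; last first.
      by rewrite ?if_same mul0r.
    rewrite [X in _ + X]big1 ?addr0 => [|j _]; last by rewrite ?if_same mul0r.
    by [].
  + rewrite !mul0r !addr0 wE2 /wA addrC; congr (_ + _).
    rewrite -(sum_pick (out S) (fun j => (i == out S) * wire S a b j)).
    by apply: eq_bigr => j _; case: (i == _); case: (j == _);
       rewrite ?mul0r ?mulr0 ?mul1r.
  + by rewrite !mul0r !addr0 wE2 big1 ?add0r // => j _; rewrite mul0r.
  + by rewrite !mul0r !addr0 wE2.
  + by rewrite !mul0r !addr0 wE2.
  + have big0 (F : I -> bool) : \sum_j false * F j = 0.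
      by rewrite big1 // => j _; rewrite mul0r.
    rewrite !big0 !add0r !mul1r mul0r !addr0.
    rewrite /zerr offset_adjval /hA /hB addrACA -!big_split /=.
    apply: eq_bigr => j _; rewrite -!mulrDl /xsign /noise.
    by case: (own S j); rewrite /= ?addr0 ?add0r.
- by split=> //; rewrite !card_sum card_unit; move: #|I| => c; lia.
Qed.

End GadgetError.
Arguments noise {al be} S oA oB i.
Arguments xsign {al be} S oA oB i.
Arguments offset {al be} S a b oA oB.
Arguments zerr {al be} S a b oA oB.

(** * Shared-entanglement amplitudes *)

Lemma sum_prod (V : nmodType) (I J : finType) (F : I * J -> V) :
  \sum_p F p = \sum_i \sum_j F (i, j).
Proof. by rewrite pair_bigA; apply: eq_bigr => -[]. Qed.

Lemma sum_delta (R : pzRingType) (I : finType) (o : I) (F : I -> R) :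
  \sum_j (j == o)%:R * F j = F o.
Proof.
rewrite (bigD1 o) //= eqxx mul1r big1 ?addr0 // => j /negPf->.
by rewrite mul0r.
Qed.

Definition isometric (X T : finType) (k : T -> X -> algC) :=
  forall x x', \sum_t (k t x)^* * k t x' = (x == x')%:R.

(* Amplitude of outcomes [a], [b] and of Alice being left with [d], on inputs
   [x], [y]; Bob keeps only his outcome.  The factor #|E|^(-1/2) of the
   entangled state on E x E is left out. *)
Definition impl (A B D al be : finType) (m : nat)
    (F : al -> be -> D -> A -> B -> algC) : Prop :=
  exists (E : finType) (m' : nat) (l : al * D -> A * E -> algC)
         (r : be -> E * B -> algC),
    [/\ (m' <= m)%N, #|E| = (2 ^ m')%N, isometric l, isometric r &
      forall a b d x y, F a b d x y = \sum_e l (a, d) (x, e) * r b (e, y)].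

(* A later step acting on Alice's register only, whose local operations may
   depend on the earlier outcomes of the same party. *)
Definition gadget (D D' al be al2 be2 : finType) (m : nat)
    (G : al -> be -> al2 -> be2 -> D' -> D -> algC) : Prop :=
  exists (E : finType) (m' : nat) (l : al -> al2 * D' -> D * E -> algC)
         (r : be -> be2 -> E -> algC),
    [/\ (m' <= m)%N, #|E| = (2 ^ m')%N, forall a, isometric (l a),
      forall b, isometric (r b) &
      forall a b a2 b2 d' d,
        G a b a2 b2 d' d = \sum_e l a (a2, d') (d, e) * r b b2 e].

Lemma gadget_local (D al be : finType) (W : D -> D -> algC) : isometric W ->
  @gadget D D al be unit unit 0 (fun _ _ _ _ => W).
Proof.
move=> isoW; exists unit, 0%N, (fun _ t s => W t.2 s.1), (fun _ _ _ => 1).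
split=> //; first by rewrite card_unit.
- move=> _ [d []] [d' []]; rewrite sum_prod /= sum_unit isoW.
  by congr (nat_of_bool _)%:R; rewrite -pair_eqE /= andbT.
- by move=> _ [] []; rewrite sum_unit conjC1 mulr1.
- by move=> *; rewrite sum_unit mulr1.
Qed.

(** The entangled states are tensored, so the pairs add up. Alice's isometry follows by summing
    first over the second outcomes, with the earlier outcome fixed, and then over the first ones. *)
Lemma impl_comp (A B D D' al be al2 be2 : finType) m m'
    (F : al -> be -> D -> A -> B -> algC)
    (G : al -> be -> al2 -> be2 -> D' -> D -> algC) :
  impl m F -> gadget m' G ->
  @impl A B D' (al * al2)%type (be * be2)%type (m + m')
    (fun a b d' x y => \sum_d G a.1 b.1 a.2 b.2 d' d * F a.1 b.1 d x y).
Proof.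
move=> [E [n [l [r [le_n cE isol isor FE]]]]].
move=> [E2 [n2 [l2 [r2 [le_n2 cE2 isol2 isor2 GE]]]]].
exists (E * E2)%type, (n + n2)%N,
  (fun t s => \sum_d l2 t.1.1 (t.1.2, t.2) (d, s.2.2) * l (t.1.1, d) (s.1, s.2.1)),
  (fun t s => r t.1 (s.1.1, s.2) * r2 t.1 t.2 s.1.2).
split; first by rewrite leq_add.
- by rewrite card_prod cE cE2 expnD.
- move=> [x [e e2]] [x' [e' e2']] /=; rewrite !sum_prod /=.
  transitivity (\sum_a \sum_d \sum_d' (l (a, d) (x, e))^* * l (a, d') (x', e')
     * \sum_t (l2 a t (d, e2))^* * l2 a t (d', e2')).
    apply: eq_bigr => a _.
    under eq_bigr => i _ do under eq_bigr => j _ do rewrite rmorph_sum mulr_suml.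
    rewrite -(sum_prod (fun t => \sum_i (l2 a t (i, e2) * l (a, i) (x, e))^* *
       \sum_d l2 a t (d, e2') * l (a, d) (x', e'))) exchange_big.
    apply: eq_bigr => d _ /=.
    under eq_bigr => t _ do rewrite mulr_sumr.
    rewrite exchange_big; apply: eq_bigr => d' _; rewrite mulr_sumr.
    by apply: eq_bigr => t _; rewrite rmorphM; ring.
  have step a d : \sum_d' (l (a, d) (x, e))^* * l (a, d') (x', e')
     * (\sum_t (l2 a t (d, e2))^* * l2 a t (d', e2'))
     = (l (a, d) (x, e))^* * l (a, d) (x', e') * (e2 == e2')%:R.
    rewrite -(sum_delta d (fun d' => (l (a, d) (x, e))^* * l (a, d') (x', e')
      * (e2 == e2')%:R)); apply: eq_bigr => d' _.
    rewrite isol2 -pair_eqE /= [d == d']eq_sym -mulnb natrM; ring.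
  under eq_bigr => a _ do under eq_bigr => d _ do rewrite step.
  under eq_bigr => a _ do rewrite -mulr_suml.
  rewrite -mulr_suml -(sum_prod (fun t => (l t (x, e))^* * l t (x', e'))) isol.
  by rewrite -natrM mulnb -!pair_eqE /= -!pair_eqE /= !andbA.
- move=> [[e e2] y] [[e' e2'] y'] /=; rewrite sum_prod /=.
  under eq_bigr => b _.
    under eq_bigr => b2 _ do rewrite rmorphM mulrACA.
    rewrite -mulr_sumr isor2; over.
  rewrite -mulr_suml isor -natrM mulnb -!pair_eqE /= -!pair_eqE /=.
  by rewrite andbAC.
- move=> [a a2] [b b2] d' x y /=; rewrite sum_prod /=.
  under eq_bigr => d _ do rewrite GE FE mulr_suml.
  rewrite exchange_big /=.
  under eq_bigr => e2 _ do under eq_bigr => d _ do rewrite mulr_sumr.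
  under eq_bigr => e2 _ do rewrite exchange_big /=.
  rewrite exchange_big /=; apply: eq_bigr => e _; apply: eq_bigr => e2 _.
  by rewrite mulr_suml; apply: eq_bigr => d _; ring.
Qed.

Lemma impl_ext (A B D al be : finType) m
    (F F' : al -> be -> D -> A -> B -> algC) :
  (forall a b d x y, F' a b d x y = F a b d x y) -> impl m F -> impl m F'.
Proof.
move=> eF [E [n [l [r [le_n cE isol isor FE]]]]].
by exists E, n, l, r; split=> // *; rewrite eF FE.
Qed.

(** * Undoing a nonlocally controlled S gate *)

Definition sg (b : bool) : algC := (-1) ^+ b.

Lemma sgD (b c : bool) : sg (b + c) = sg b * sg c.
Proof. exact: signr_addb. Qed.

Lemma sg0 : sg 0 = 1. Proof. by []. Qed.

Lemma sg_sum (I : Type) (s : seq I) (F : I -> bool) :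
  sg (\sum_(i <- s) F i) = \prod_(i <- s) sg (F i).
Proof. exact: (big_morph sg sgD sg0). Qed.

Lemma andb_mul (b c : bool) : b && c = b * c. Proof. by []. Qed.

Lemma sgK (b : bool) : sg b * sg b = 1.
Proof. by rewrite -sgD addbool2. Qed.

Lemma conj_sg (b : bool) : (sg b)^* = sg b.
Proof. by rewrite /sg rmorphXn rmorphN1. Qed.

(** As integers, the exclusive or is b + c - 2bc, and (-i)^(-2bc) is the sign (-1)^(bc). This cross
    term is the source of the product f q_out. *)
Lemma expNiD (b c : bool) :
  (- 'i) ^+ ((b + c)%R : bool) = (- 'i) ^+ b * (- 'i) ^+ c * sg (b * c) :> algC.
Proof.
case: b c => [] []; rewrite /sg /= ?expr0 ?expr1 ?mulr1 ?mul1r //.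
by rewrite mulrNN -expr2 sqrCi mulN1r opprK.
Qed.

Lemma prod_natb (R : comPzRingType) (I : finType) (P : pred I) :
  \prod_i (P i)%:R = [forall i, P i]%:R :> R.
Proof.
have [/forallP P1|/forallPn[i nPi]] := boolP [forall i, P i].
  by rewrite big1 // => i _; rewrite P1.
by rewrite (bigD1 i) //= (negPf nPi) mul0r.
Qed.

(* Amplitude of outcome [o] when a party measures the parity [v] ([own]) or
   measures the bit [e] in the X basis (otherwise). *)
Definition meas (own o v e : bool) : algC :=
  if own then (o == v)%:R else sg (o && e) / sqrtC 2.

Lemma conj_sqrt2V : ((sqrtC 2)^-1 : algC)^* = (sqrtC 2)^-1.
Proof. by apply/CrealP; rewrite rpredV ger0_real // sqrtC_ge0. Qed.

Lemma conjcM (x z : algC) : (x * z)^* = x^* * z^*.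
Proof. exact: rmorphM. Qed.

Lemma conjc_prod (I : Type) (s : seq I) (F : I -> algC) :
  (\prod_(i <- s) F i)^* = \prod_(i <- s) (F i)^*.
Proof. exact: rmorph_prod. Qed.

Lemma meas_tp own v e v' e' :
  \sum_o (meas own o v e)^* * meas own o v' e' =
  (if own then v == v' else e == e')%:R.
Proof.
rewrite /meas big_bool /=; case: own.
  by rewrite !conjC_nat; case: v v' => [] []; rewrite /= ?mulr0 ?mul0r ?mulr1
    ?addr0 ?add0r.
rewrite !conjcM !conj_sg !conj_sqrt2V !mulf_div -expr2 sqrtCK -mulrDl /sg.
by case: e e' => [] []; rewrite /= ?expr0 ?expr1; field.
Qed.

Lemma sum_conj_delta (D : finType) (d d' : D) (x z u v : algC) :
  \sum_j ((j == d)%:R * x * z)^* * ((j == d')%:R * u * v) =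
  (d == d')%:R * (x^* * u) * (z^* * v).
Proof.
rewrite -[in RHS](sum_delta d (fun j => (j == d')%:R)) !mulr_suml.
by apply: eq_bigr => j _; rewrite !conjcM conjC_nat; ring.
Qed.

Lemma meas_prod_tp (I : finType) (own : pred I) (v v' e e' : I -> bool) :
  \sum_(o : {ffun I -> bool}) (\prod_i meas (own i) (o i) (v i) (e i))^* *
    \prod_i meas (own i) (o i) (v' i) (e' i) =
  [forall i, if own i then v i == v' i else e i == e' i]%:R.
Proof.
rewrite -prod_natb; under [LHS]eq_bigr do rewrite conjc_prod -big_split /=.
rewrite -(bigA_distr_bigA (fun i o => (meas (own i) o (v i) (e i))^* *
   meas (own i) o (v' i) (e' i))).
by apply: eq_bigr => i _; rewrite meas_tp.
Qed.

Section Gadget.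
Variables (al be D : finType) (S : linsys al be) (y : D -> bool).
Let I := idx S.

Definition parA a d (e : {ffun I -> bool}) i : bool :=
  e i + \sum_j rowA S a i j * e j + inp S a i * y d.
Definition parB b (e : {ffun I -> bool}) i : bool :=
  e i + \sum_j rowB S b i j * e j.

(** The power of [- 'i] is an inverse S gate on her half of the output pair; the wire register
    itself is only read. *)
Definition alice a (t : {ffun I -> bool} * D) (s : D * {ffun I -> bool}) : algC :=
  (t.2 == s.1)%:R * (- 'i) ^+ (s.2 (out S)) *
  \prod_i meas (own S i) (t.1 i) (parA a s.1 s.2 i) (s.2 i).
Definition bob b (o e : {ffun I -> bool}) : algC :=
  \prod_i meas (~~ own S i) (o i) (parB b e i) (e i).

(** Bits on the other rows are given outright, and triangularity then recovers the bits on the owned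
    rows from their parities. This is what makes the local operations isometric. *)
Lemma parity_inj (own : pred I) (M : I -> I -> bool) (c : I -> bool)
    (e e' : {ffun I -> bool}) :
  triangular (rnk S) (fun i j => own i && M i j) ->
  [forall i, if own i then e i + \sum_j M i j * e j + c i ==
                           e' i + \sum_j M i j * e' j + c i
             else e i == e' i] = (e == e').
Proof.
move=> triM; apply/forallP/eqP => [par|-> i]; last by rewrite !eqxx if_same.
apply/ffunP; pose z (u : {ffun I -> bool}) i := if own i then
  u i + \sum_j M i j * u j else u i.
have sol u : solves (fun i j => own i && M i j) (z u) u.
  move=> i; rewrite /z; case: (own i); last first.
    by rewrite big1 ?add0r // => j _; rewrite mul0r.
  by rewrite addrCA addbool2 addr0.
apply: (solves_unique triM (sol e)) => i; rewrite [LHS]sol; congr (_ + _).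
have := par i; rewrite /z; case: (own i) => /eqP //.
by move/addIr.
Qed.

Lemma alice_iso a : isometric (alice a).
Proof.
move=> [d e] [d' e'] /=; rewrite sum_prod /= /alice /=.
under eq_bigr => o _ do rewrite sum_conj_delta.
rewrite -mulr_sumr meas_prod_tp -pair_eqE /=.
case: (d =P d') => [<-|_]; last by rewrite !mul0r.
rewrite mul1r parity_inj => [|i j /andP[]]; last exact: rowAP.
case: (e =P e') => [<-|_]; last by rewrite mulr0.
by rewrite mulr1 mulrC -normCK normrX normrN normCi !expr1n.
Qed.

Lemma bob_iso b : isometric (bob b).
Proof.
move=> e e'; rewrite meas_prod_tp.
rewrite -(@parity_inj (fun i => ~~ own S i) (rowB S b) (fun=> 0)).
  by congr (nat_of_bool _)%:R; apply: eq_forallb => i; rewrite !addr0.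
by move=> i j /andP[]; exact: rowBP.
Qed.

(** Collects the factors free of the wire bit, which form a mere scalar once the outcomes are
    fixed. *)
Definition gphase a b oA oB : algC :=
  (- 'i) ^+ (offset S a b oA oB (out S)) *
  \prod_i (sg (xsign S oA oB i * offset S a b oA oB i) / sqrtC 2).

(** On every row the owner's measurement forces one equation, and together they leave the single
    string r = p y + q. On it the phase (-i)^(f y + q_out) splits into the wanted inverse of S^f on
    the wire and a cross sign, which joins the signs of the X-basis measurements to form the Z
    error. *)
Lemma gadget_amp a b oA oB d' d :
  \sum_e alice a (oA, d') (d, e) * bob b oB e =
  gphase a b oA oB * ((d' == d)%:R * (- 'i) ^+ (wire S a b (out S) && y d) *
    sg (zerr S a b oA oB && y d)).
Proof.
pose q := offset S a b oA oB.
pose r := [ffun i => wire S a b i * y d + q i].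
have qP : solves (coef S a b) (noise S oA oB) q := solutionP (@coefP _ _ S a b) _.
have rP : solves (coef S a b) (fun i => (own S i && inp S a i) * y d + noise S oA oB i) r.
  move=> i; rewrite ffunE wireP qP mulrDl addrACA; congr (_ + _).
  rewrite mulr_suml -big_split /=; apply: eq_bigr => j _.
  by rewrite ffunE mulrDr mulrA.
have amp e : alice a (oA, d') (d, e) * bob b oB e =
   (e == r)%:R * ((d' == d)%:R * (- 'i) ^+ (e (out S)) *
     \prod_i (sg (xsign S oA oB i * e i) / sqrtC 2)).
  rewrite /alice /bob /= -[LHS]mulrA -big_split /=.
  rewrite mulrCA; congr (_ * _).
  have -> : (e == r) = [forall i, noise S oA oB i == e i + \sum_j coef S a b i j * e j
      + (own S i && inp S a i) * y d].
    apply/eqP/forallP => [-> i|sol].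
      apply/eqP; rewrite [r i in RHS]rP; move: (\sum_j _) (_ * y d) (noise _ _ _ _).
      by case=> [] [] [].
    apply/ffunP; apply: (solves_unique (@coefP _ _ S a b) _ rP) => i.
    rewrite (eqP (sol i)); move: (\sum_j _) (_ * y d) (e i).
    by case=> [] [] [].
  rewrite -prod_natb -big_split; apply: eq_bigr => i _ /=.
  rewrite /meas /parA /parB /coef /noise /xsign.
  by case: (own S i); rewrite /= ?mul0r ?addr0 // mulrC.
under eq_bigr => e _ do rewrite amp.
rewrite sum_delta ffunE expNiD /gphase /zerr -/q.
under eq_bigr => i _ do rewrite ffunE mulrDr sgD -mulrA.
rewrite big_split -sg_sum /=.
have -> : zerr S a b oA oB && y d = (\sum_i xsign S oA oB i * (wire S a b i * y d))
   + wire S a b (out S) * y d * q (out S).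
  rewrite andb_mul /zerr -/q mulrDl mulr_suml mulrAC; congr (_ + _).
  by apply: eq_bigr => i _; rewrite mulrA.
by rewrite sgD [wire _ _ _ _ && _]andb_mul; ring.
Qed.

Lemma gadget_phase :
  @gadget D D al be _ _ #|I| (fun a b a2 b2 d' d => gphase a b a2 b2 *
    ((d' == d)%:R * (- 'i) ^+ (wire S a b (out S) && y d) *
    sg (zerr S a b a2 b2 && y d))).
Proof.
exists {ffun I -> bool}, #|I|, alice, bob; split=> //.
- by rewrite card_ffun card_bool.
- exact: alice_iso.
- exact: bob_iso.
- by move=> *; rewrite gadget_amp.
Qed.
End Gadget.

(** * Pauli strings and Cliffords *)

Definition qadd n (x y : Q n) : Q n := [ffun k => x k + y k].
Definition dot n (z y : Q n) : bool := \sum_k z k * y k.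
Definition q0 n : Q n := [ffun=> false].

Section QubitLabels.
Variable n : nat.
Implicit Types x y z : Q n.

Lemma qaddK x y : qadd (qadd x y) y = x.
Proof. by apply/ffunP => k; rewrite !ffunE -addrA addbool2 addr0. Qed.

Lemma qadd0 x : qadd x (q0 n) = x.
Proof. by apply/ffunP => k; rewrite !ffunE addr0. Qed.

Lemma qaddA x y z : qadd x (qadd y z) = qadd (qadd x y) z.
Proof. by apply/ffunP => k; rewrite !ffunE addrA. Qed.

Lemma qaddC x y : qadd x y = qadd y x.
Proof. by apply/ffunP => k; rewrite !ffunE addrC. Qed.

Lemma eq_qadd x y z : (x == qadd y z) = (y == qadd x z).
Proof. by apply/eqP/eqP => ->; rewrite qaddK. Qed.

Lemma dotDr z x y : dot z (qadd x y) = dot z x + dot z y.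
Proof.
by rewrite /dot -big_split; apply: eq_bigr => k _; rewrite ffunE mulrDr.
Qed.

Lemma dotDl z x y : dot (qadd x y) z = dot x z + dot y z.
Proof.
by rewrite /dot -big_split; apply: eq_bigr => k _; rewrite ffunE mulrDl.
Qed.

Lemma dot0 y : dot (q0 n) y = 0.
Proof. by rewrite /dot big1 // => k _; rewrite ffunE mul0r. Qed.

Lemma sum_qadd (V : nmodType) x (F : Q n -> V) : \sum_y F y = \sum_y F (qadd y x).
Proof.
rewrite (reindex_inj (h := fun y => qadd y x)) //= => y y' /(congr1 (fun t => qadd t x)).
by rewrite !qaddK.
Qed.

Lemma expr_card_set (w : algC) (A : {set 'I_n}) (y : Q n) :
  w ^+ #|[set k in A | y k]| = \prod_(k in A) w ^+ y k.
Proof.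
rewrite -prodr_const (big_setID A) /= [X in _ * X]big_pred0 ?mulr1; last first.
  by move=> k; rewrite !inE; case: (k \in A).
rewrite big_mkcond [RHS]big_mkcond; apply: eq_bigr => k _.
by rewrite !inE; case: (k \in A); case: (y k).
Qed.

Lemma pauliE x z j i : pauli x z j i = (j == qadd i x)%:R * sg (dot z i).
Proof.
rewrite /pauli /dot sg_sum.
have -> : [ffun k => xorb (i k) (x k)] = qadd i x.
  by apply/ffunP => k; rewrite !ffunE; case: (i k) (x k) => [] [].
congr (_ * _).
rewrite (_ : #|_| = #|[set k in [set k | z k] | i k]|); last first.
  by apply: eq_card => k; rewrite !inE.
rewrite expr_card_set big_mkcond; apply: eq_bigr => k _.
by rewrite inE; case: (z k); case: (i k).
Qed.

End QubitLabels.

Lemma mulopA (I J K L : finType) (X : Op K L) (Y : Op J K) (Z : Op I J) l i :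
  mulop (mulop X Y) Z l i = mulop X (mulop Y Z) l i.
Proof.
rewrite /mulop; under eq_bigr => j _ do rewrite mulr_suml.
rewrite exchange_big; apply: eq_bigr => k _; rewrite mulr_sumr.
by apply: eq_bigr => j _; rewrite mulrA.
Qed.

Lemma eq_mulop (I J K : finType) (X X' : Op J K) (Y Y' : Op I J) :
  (forall k j, X k j = X' k j) -> (forall j i, Y j i = Y' j i) ->
  forall k i, mulop X Y k i = mulop X' Y' k i.
Proof. by move=> eX eY k i; apply: eq_bigr => j _; rewrite eX eY. Qed.

Lemma mulop1 (I J : finType) (X : Op I J) j i : mulop X (@idop I) j i = X j i.
Proof.
rewrite /mulop -[RHS](sum_delta i (fun k => X j k)).
by apply: eq_bigr => k _; rewrite mulrC.
Qed.

Section CliffordAction.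
Variables (n : nat) (C : Op (Q n) (Q n)).

(* Entrywise form of C X^x Z^z = c' X^x' Z^z' C; the constant sign
   (-1)^(z'.x') is absorbed into [c]. *)
Definition carries (x z x' z' : Q n) : Prop :=
  exists c, forall j i,
    C j (qadd i x) = c * (sg (dot z i) * sg (dot z' j)) * C (qadd j x') i.

Lemma carries0 : carries (q0 n) (q0 n) (q0 n) (q0 n).
Proof. by exists 1 => j i; rewrite !qadd0 !dot0 sg0 !mulr1 mul1r. Qed.

(** Moving Z strings past X strings costs only signs that depend on these strings, and they go into
    the constant. *)
Lemma carriesD x1 z1 x1' z1' x2 z2 x2' z2' :
  carries x1 z1 x1' z1' -> carries x2 z2 x2' z2' ->
  carries (qadd x1 x2) (qadd z1 z2) (qadd x1' x2') (qadd z1' z2').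
Proof.
move=> [c1 H1] [c2 H2].
exists (c1 * c2 * (sg (dot z1 x2) * sg (dot z2' x1'))) => j i.
rewrite [qadd x1 x2]qaddC !qaddA H1 H2 dotDr sgD [dot z2' (qadd _ _)]dotDr.
by rewrite !dotDl !sgD; ring.
Qed.

Lemma clifford_carries x z : clifford C ->
  exists p : Q n * Q n, carries x z p.1 p.2.
Proof.
move=> [uC /(_ 0%N x z) [c [x' [z' H]]]]; exists (x', z').
exists ('i ^+ c * sg (dot z' x')) => j i.
(* Multiplying C P C^dagger = P' by C on the right gives C P = P' C. *)
have : mulop (mulop C (pauli_elt 0 x z)) (@idop (Q n)) j i =
       mulop (pauli_elt c x' z') C j i.
  rewrite -(eq_mulop H (fun _ _ => erefl)) [RHS]mulopA.
  by apply: eq_mulop => // k k'; have [-> _] := uC k k'.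
rewrite mulop1 /mulop /pauli_elt => E.
have L : \sum_k C j k * ('i ^+ 0 * pauli x z k i) = C j (qadd i x) * sg (dot z i).
  rewrite -(sum_delta (qadd i x) (fun k => C j k * sg (dot z i))).
  by apply: eq_bigr => k _; rewrite pauliE expr0; ring.
have R : \sum_k 'i ^+ c * pauli x' z' j k * C k i =
   'i ^+ c * sg (dot z' (qadd j x')) * C (qadd j x') i.
  rewrite -(sum_delta (qadd j x') (fun k => 'i ^+ c * sg (dot z' k) * C k i)).
  by apply: eq_bigr => k _; rewrite pauliE eq_qadd; ring.
rewrite L R in E.
have := congr1 (fun t => t * sg (dot z i)) E.
rewrite /= -mulrA sgK mulr1 => ->.
by rewrite dotDr sgD; ring.
Qed.

Definition gen (t : 'I_n + 'I_n) : Q n * Q n :=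
  match t with
  | inl i => ([ffun k => i == k], q0 n)
  | inr i => (q0 n, [ffun k => i == k])
  end.
Definition bitof (x z : Q n) (t : 'I_n + 'I_n) : bool :=
  match t with inl i => x i | inr i => z i end.

(** Images are chosen on the generators X_i and Z_i and extended additively by [carriesD]; [X] and
    [Z] list the columns of a matrix over F_2 acting on the error bits. *)
Lemma clifford_linear : clifford C ->
  exists X Z : 'I_n + 'I_n -> Q n, forall x z,
    carries x z [ffun k => \sum_(t <- enum {: 'I_n + 'I_n}) X t k * bitof x z t]
                [ffun k => \sum_(t <- enum {: 'I_n + 'I_n}) Z t k * bitof x z t].
Proof.
move=> clC.
have [p pP] := fin_all_exists (fun t => clifford_carries (gen t).1 (gen t).2 clC).
exists (fun t => (p t).1), (fun t => (p t).2) => x z.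
have main s : carries [ffun k => \sum_(t <- s) (gen t).1 k * bitof x z t]
   [ffun k => \sum_(t <- s) (gen t).2 k * bitof x z t]
   [ffun k => \sum_(t <- s) (p t).1 k * bitof x z t]
   [ffun k => \sum_(t <- s) (p t).2 k * bitof x z t].
  elim: s => [|t s IHs].
    have E (F : 'I_n -> 'I_n + 'I_n -> bool) :
       [ffun k => \sum_(t <- [::]) F k t] = q0 n.
      by apply/ffunP => k; rewrite !ffunE big_nil.
    by rewrite !E; exact: carries0.
  have E (F : 'I_n + 'I_n -> Q n) : [ffun k => \sum_(t <- t :: s) F t k * bitof x z t]
    = if bitof x z t then qadd (F t) [ffun k => \sum_(t <- s) F t k * bitof x z t]
      else [ffun k => \sum_(t <- s) F t k * bitof x z t].
    case: ifP => bt; apply/ffunP => k; rewrite !ffunE big_cons bt.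
      by rewrite mulr1.
    by rewrite mulr0 add0r.
  rewrite !(E (fun t => (gen t).1), E (fun t => (gen t).2),
            E (fun t => (p t).1), E (fun t => (p t).2)).
  by case: (bitof x z t) => //; apply: carriesD.
have := main (enum {: 'I_n + 'I_n}).
have -> : [ffun k => \sum_(t <- enum {: 'I_n + 'I_n}) (gen t).1 k * bitof x z t] = x.
  apply/ffunP => k; rewrite ffunE big_enum big_sumType /=.
  rewrite [X in _ + X]big1 ?addr0 => [|i _]; last by rewrite ffunE mul0r.
  by rewrite -[RHS](sum_pick k (fun i => x i)); apply: eq_bigr => i _; rewrite ffunE.
have -> // : [ffun k => \sum_(t <- enum {: 'I_n + 'I_n}) (gen t).2 k * bitof x z t] = z.
apply/ffunP => k; rewrite ffunE big_enum big_sumType /=.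
rewrite [X in X + _]big1 ?add0r => [|i _]; last by rewrite ffunE mul0r.
by rewrite -[RHS](sum_pick k (fun i => z i)); apply: eq_bigr => i _; rewrite ffunE.
Qed.

End CliffordAction.

(** * Teleportation and Clifford layers *)

Lemma impl_leq (A B D al be : finType) m m' (F : al -> be -> D -> A -> B -> algC) :
  (m <= m')%N -> impl m F -> impl m' F.
Proof.
move=> le_m [E [n [l [r [le_n cE isol isor FE]]]]].
by exists E, n, l, r; split=> //; apply: leq_trans le_m.
Qed.

Section Rounds.
Variables na nb : nat.
Let n := (na + nb)%N.

(** Alice holds Z^z X^x U applied to both inputs; the scalar [lam] depends on the outcomes alone. *)
Definition paulied (al be : finType) (U : Op (Q n) (Q n)) (lam : al -> be -> algC)
    (x z : al -> be -> Q n) : al -> be -> Q n -> Q na -> Q nb -> algC :=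
  fun a b d ia ib =>
    lam a b * (sg (dot (z a b) d) * U (qadd d (x a b)) (qjoin ia ib)).

Lemma eq_qjoin (xa xa' : Q na) (xb xb' : Q nb) :
  (qjoin xa xb == qjoin xa' xb') = (xa == xa') && (xb == xb').
Proof.
apply/eqP/andP => [/ffunP E|[/eqP-> /eqP->]//].
split; apply/eqP/ffunP => k.
  by have := E (lshift nb k); rewrite !ffunE (unsplitK (inl _ k)).
by have := E (rshift na k); rewrite !ffunE (unsplitK (inr _ k)).
Qed.

Lemma qadd_qjoin (xa xa' : Q na) (xb xb' : Q nb) :
  qadd (qjoin xa xb) (qjoin xa' xb') = qjoin (qadd xa xa') (qadd xb xb').
Proof. by apply/ffunP => k; rewrite !ffunE; case: (split k) => i; rewrite ffunE. Qed.

Lemma dot_qjoin (xa xa' : Q na) (xb xb' : Q nb) :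
  dot (qjoin xa xb) (qjoin xa' xb') = dot xa xa' + dot xb xb'.
Proof.
rewrite /dot big_split_ord; congr (_ + _); apply: eq_bigr => k _;
  rewrite !ffunE.
  by rewrite (unsplitK (inl _ k)).
by rewrite (unsplitK (inr _ k)).
Qed.

Lemma teleport : exists lam, impl nb
  (@paulied unit (Q nb * Q nb)%type (@idop (Q n)) lam
    (fun _ t => qjoin (q0 na) t.1) (fun _ t => qjoin (q0 na) t.2)).
Proof.
exists (fun _ t => sg (dot t.2 t.1) / \prod_(k < nb) sqrtC 2).
exists (Q nb), nb, (fun t s => (t.2 == qjoin s.1 s.2)%:R),
  (* Bob's Bell measurement: the parity of each input bit with his half of a pair gives the X error,
     and the X-basis outcome of the input bit gives the Z error. *)
  (fun t s : Q nb * Q nb => (\prod_k meas true (t.1 k) (s.1 k + s.2 k) 0) *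
              \prod_k meas false (t.2 k) false (s.2 k)).
split=> //; first by rewrite card_ffun card_bool card_ord.
- move=> [x e] [x' e'] /=; rewrite sum_prod sum_unit /=.
  rewrite -pair_eqE /= -eq_qjoin.
  rewrite -(sum_delta (qjoin x e) (fun d => (d == qjoin x' e')%:R)).
  by apply: eq_bigr => d _; rewrite conjC_nat.
- move=> [e y] [e' y'] /=; rewrite sum_prod /=.
  under eq_bigr => u _ do under eq_bigr => s _ do rewrite conjcM mulrACA.
  under eq_bigr => u _ do rewrite -mulr_sumr.
  rewrite -mulr_suml.
  rewrite (meas_prod_tp (fun=> true) (fun k => e k + y k) (fun k => e' k + y' k)
     (fun=> 0) (fun=> 0)).
  rewrite (meas_prod_tp (fun=> false) (fun=> false) (fun=> false) y y') /=.
  rewrite -natrM mulnb -pair_eqE /=; congr (nat_of_bool _)%:R.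
  have -> : [forall i, y i == y' i] = (y == y').
    by apply/forallP/eqP => [E|-> //]; apply/ffunP => k; exact/eqP.
  case: (y =P y') => [<-|]; last by rewrite !andbF.
  rewrite !andbT; apply/forallP/eqP => [E|-> //].
  by apply/ffunP => k; apply: (@addIr _ (y k)); exact/eqP.
- move=> [] [u s] d x y; rewrite /paulied /=.
  have prE (e : Q nb) : \prod_k meas true (u k) (e k + y k) 0 = (e == qadd u y)%:R.
    rewrite (prod_natb _ (fun k => u k == e k + y k)); congr (nat_of_bool _)%:R.
    apply/forallP/eqP => [E|-> k].
      apply/ffunP => k; rewrite ffunE (eqP (E k)).
      by rewrite -addrA addbool2 addr0.
    by rewrite ffunE -addrA addbool2 addr0.
  transitivity (\sum_e (e == qadd u y)%:R *
     ((d == qjoin x e)%:R * \prod_k meas false (s k) false (y k))); last first.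
    by apply: eq_bigr => e _; rewrite -prE mulrCA.
  rewrite sum_delta /meas /= big_split /= -sg_sum prodfV.
  rewrite /idop [qadd d _ == _]eq_sym eq_qadd qadd_qjoin qadd0 [qadd y u]qaddC.
  case: eqP => [->|_]; last by rewrite !mul0r ?mulr0.
  rewrite dot_qjoin dot0 add0r [dot s (qadd u y)]dotDr sgD.
  rewrite mul1r mulr1 /dot.
  by rewrite mulrACA sgK mul1r mulrC.
Qed.

(** Shifting the summation index by the X error exposes an unshifted [U], and [carries] then moves
    the Pauli string to the left of [C]. The constant of each outcome pair goes into the new
    scalar. *)
Lemma paulied_clifford C : clifford C ->
  exists X Z : 'I_n + 'I_n -> Q n, forall (al be : finType) m U lam x z,
    impl m (@paulied al be U lam x z) -> exists lam', impl m
     (@paulied (al * unit)%type (be * unit)%type (mulop C U) lam'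
       (fun a b => [ffun k => \sum_(t <- enum {: 'I_n + 'I_n})
          X t k * bitof (x a.1 b.1) (z a.1 b.1) t])
       (fun a b => [ffun k => \sum_(t <- enum {: 'I_n + 'I_n})
          Z t k * bitof (x a.1 b.1) (z a.1 b.1) t])).
Proof.
move=> clC; have [X [Z XZ]] := clifford_linear clC.
exists X, Z => al be m U lam x z impF.
have isoC : isometric C.
  by move=> i i'; have [uC _] := clC; have [E _] := uC i i'; exact: E.
have := impl_comp impF (gadget_local al be isoC); rewrite addn0 => impCF.
pose comb (W : 'I_n + 'I_n -> Q n) (a : al * unit) (b : be * unit) : Q n :=
  [ffun k => \sum_(t <- enum {: 'I_n + 'I_n})
     W t k * bitof (x a.1 b.1) (z a.1 b.1) t].
pose x' := comb X; pose z' := comb Z.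
have /fin_all_exists[c cP] : forall t : al * be, exists c, forall j i,
    C j (qadd i (x t.1 t.2)) = c * (sg (dot (z t.1 t.2) i) *
       sg (dot (z' (t.1, tt) (t.2, tt)) j)) * C (qadd j (x' (t.1, tt) (t.2, tt))) i.
  by move=> t; exact: XZ.
exists (fun a b => lam a.1 b.1 * c (a.1, b.1) * sg (dot (z a.1 b.1) (x a.1 b.1))).
apply: impl_ext impCF => -[a []] [b []] d ia ib; rewrite /paulied /=.
rewrite /mulop [RHS](sum_qadd (x a b)) !mulr_sumr; apply: eq_bigr => k _.
rewrite (cP (a, b)) /= qaddK dotDr sgD.
by rewrite -[LHS]mulr1 -[1](sgK (dot (z a b) k)); ring.
Qed.

(** The invariant along the circuit: [m] bounds the EPR pairs spent so far, [N] the program length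
    of every error bit. *)
Definition state m N (U : Op (Q n) (Q n)) : Prop :=
  exists (al be : finType) (lam : al -> be -> algC) (x z : al -> be -> Q n),
    impl m (paulied U lam x z) /\
    forall k, lin N (fun a b => x a b k) /\ lin N (fun a b => z a b k).

Lemma state_ext m N U V : (forall j i, U j i = V j i) -> state m N U -> state m N V.
Proof.
move=> eUV [al [be [lam [x [z [impF linxz]]]]]].
exists al, be, lam, x, z; split=> //.
by apply: impl_ext impF => *; rewrite /paulied eUV.
Qed.

(** Teleportation leaves errors known to Bob alone, and after the first Clifford they are still
    functions of his outcomes, so the two rows of [lin_bob] suffice. *)
Lemma state_start C : clifford C -> state nb 2 C.
Proof.
move=> clC; apply: (@state_ext _ _ (mulop C (@idop (Q n)))) => [j i|].
  exact: mulop1.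
have [lam impT] := teleport; have [X [Z XZ]] := paulied_clifford clC.
have [lam' impC] := XZ _ _ _ _ _ _ _ impT.
do 5!eexists; split; [exact: impC|move=> k]; split.
  apply: (lin_ext (f := fun _ b => [ffun k => \sum_(t <- enum {: 'I_n + 'I_n})
      X t k * bitof (qjoin (q0 na) b.1.1) (qjoin (q0 na) b.1.2) t] k)) => //.
  exact: lin_bob.
apply: (lin_ext (f := fun _ b => [ffun k => \sum_(t <- enum {: 'I_n + 'I_n})
      Z t k * bitof (qjoin (q0 na) b.1.1) (qjoin (q0 na) b.1.2) t] k)) => //.
exact: lin_bob.
Qed.

Lemma state_clifford m N U C : clifford C -> state m N U ->
  state m ((n + n) * N.+1).+1 (mulop C U).
Proof.
move=> clC [al [be [lam [x [z [impF linxz]]]]]].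
have [X [Z XZ]] := paulied_clifford clC.
have [lam' impC] := XZ _ _ _ _ _ _ _ impF.
do 5!eexists; split; [exact: impC|move=> k].
have sz : size (enum {: 'I_n + 'I_n}) = (n + n)%N.
  by rewrite -cardE card_sum card_ord.
have linb t : @lin (al * unit)%type (be * unit)%type N
    (fun a b => bitof (x a.1 b.1) (z a.1 b.1) t).
  by case: t => i; have [lx lz] := linxz i; [move: lx|move: lz]; exact: lin_pull.
rewrite -sz; split.
  apply: lin_ext (lin_sum (enum {: 'I_n + 'I_n}) (fun t => X t k) linb) => a b.
  by rewrite ffunE.
apply: lin_ext (lin_sum (enum {: 'I_n + 'I_n}) (fun t => Z t k) linb) => a b.
by rewrite ffunE.
Qed.

End Rounds.

(** * T layers *)

Lemma omega8_sq : omega8 ^+ 2 = 'i.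
Proof.
rewrite /omega8 expr_div_n sqrtCK sqrrD sqrCi expr1n mul1r addrC addrA addNr add0r.
by rewrite -mulr_natr mulfK // pnatr_eq0.
Qed.

Lemma omega8_neq0 : omega8 != 0.
Proof.
by apply/eqP => w0; have /eqP := omega8_sq; rewrite w0 expr0n eq_sym (negPf (neq0Ci _)).
Qed.

Lemma norm_omega8 : `|omega8| = 1.
Proof.
by apply/eqP; rewrite -(pexpr_eq1 (n := 2)) // -normrX omega8_sq normCi.
Qed.

Lemma tlayerE n (S : {set 'I_n}) j i :
  tlayer S j i = (j == i)%:R * \prod_(k in S) omega8 ^+ i k.
Proof. by rewrite /tlayer expr_card_set. Qed.

Lemma tlayer_unitary n (S : {set 'I_n}) : isometric (tlayer S).
Proof.
move=> i i'; rewrite -[RHS](sum_delta i (fun j => (j == i')%:R)).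
apply: eq_bigr => j _; rewrite /tlayer conjcM conjC_nat.
case: (j =P i) => [->|_]; last by rewrite !mul0r.
case: (i =P i') => [<-|_]; last by rewrite mul0r !mulr0.
by rewrite !mul1r mulrC -normCK normrX norm_omega8 !expr1n.
Qed.

(* Commuting a T layer past a Pauli string leaves an S gate on every wire of
   the layer that carries an X error. *)
Lemma tlayer_shift n (S : {set 'I_n}) (x d : Q n) :
  \prod_(k in S) omega8 ^+ d k =
  (\prod_(k in S) omega8^-1 ^+ x k) * (\prod_(k <- enum S) 'i ^+ (x k && d k)) *
  \prod_(k in S) omega8 ^+ qadd d x k.
Proof.
rewrite [X in _ * X * _]big_enum -!big_split; apply: eq_bigr => k _ /=.
rewrite ffunE; have w0 := omega8_neq0.
case: (x k) (d k) => [] [] /=; rewrite ?expr0 ?expr1 ?mulr1 ?mul1r ?mulVf //.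
by rewrite -omega8_sq expr2 mulKf.
Qed.

Section TLayer.
Variables na nb : nat.
Let n := (na + nb)%N.

(** Wires are treated one by one. A gadget leaves the X errors alone, so each wire costs at most [N]
    pairs; it lengthens only the Z program of its own wire, from [N] to N + (3N + 3) + 1 at most.
    Hence wires still in [s] keep length [N] while treated ones are allowed [N']. *)
Lemma phases_cancel N N' (U : Op (Q n) (Q n)) (s : seq 'I_n) :
  (4 * N + 4 <= N')%N -> uniq s ->
  forall (al be : finType) m (lam : al -> be -> algC) (x z : al -> be -> Q n),
  @impl (Q na) (Q nb) (Q n) al be m (fun a b d ia ib =>
    (\prod_(k <- s) 'i ^+ (x a b k && d k)) * paulied U lam x z a b d ia ib) ->
  (forall k, lin N (fun a b => x a b k)) ->
  (forall k, lin (if k \in s then N else N') (fun a b => z a b k)) ->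
  @state na nb (m + size s * N) N' U.
Proof.
move=> leN; elim: s => [|k s IHs] /=.
  move=> _ al' be' m' lam x z impF linx linz.
  exists al', be', lam, x, z; split.
    rewrite addn0; apply: impl_ext impF => *.
    by rewrite big_nil mul1r.
  by move=> k; split; [apply: lin_leq (linx k); lia | exact: linz].
move=> /andP[ks us] al' be' m' lam x z impF linx linz.
have [T [cT xT]] := linx k.
have gT := gadget_phase T (fun d : Q n => d k).
have impG := impl_comp impF gT.
pose h (a : al' * {ffun idx T -> bool}) (b : be' * {ffun idx T -> bool}) :=
  zerr T a.1 b.1 a.2 b.2.
pose z' a b : Q n := [ffun j => z a.1 b.1 j + (j == k) * h a b].
rewrite addnA; apply: (IHs us _ _ _ (fun a b => gphase a.1 b.1 a.2 b.2 * lam a.1 b.1)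
  (fun a b => x a.1 b.1) z').
- apply: impl_ext (impl_leq _ impG) => [[a a2] [b b2] d ia ib|]; last by lia.
  rewrite /paulied /=.
  pose rest := \prod_(j <- k :: s) 'i ^+ (x a b j && d j) *
     (lam a b * (sg (dot (z a b) d) * U (qadd d (x a b)) (qjoin ia ib))) : algC.
  transitivity (gphase a b a2 b2 * (- 'i) ^+ (x a b k && d k) *
     sg (h (a, a2) (b, b2) && d k) * rest); last first.
    rewrite -(sum_delta d (fun d0 => gphase a b a2 b2 *
      (- 'i) ^+ (x a b k && d k) * sg (h (a, a2) (b, b2) && d k) * rest)).
    apply: eq_bigr => d0 _; rewrite [d == d0]eq_sym.
    case: eqP => [->|_]; last by rewrite !mul0r mulr0 mul0r.
    by rewrite !mul1r -xT /h [gphase _ _ _ _ * (_ * _)]mulrA.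
  rewrite /rest big_cons.
  have -> : dot (z' (a, a2) (b, b2)) d = dot (z a b) d + h (a, a2) (b, b2) * d k.
    rewrite -(sum_pick k (fun j => h (a, a2) (b, b2) * d j)) /dot -big_split.
    by apply: eq_bigr => j _; rewrite ffunE mulrDl mulrA.
  have Ii (c : bool) : 'i ^+ c * (- 'i) ^+ c = 1 :> algC.
    by case: c; rewrite ?expr0 ?mulr1 // mulrN -expr2 sqrCi opprK.
  rewrite sgD andb_mul -[LHS]mul1r -(Ii (x a b k && d k)).
  by ring.
- by move=> j; exact: lin_pull (linx j).
- move=> j; case: (boolP (j == k)) => [/eqP->|jk].
    rewrite (negPf ks).
    apply: lin_ext (lin_leq _ (lin_add (lin_pull fst fst (linz k)) (lin_zerr T))).
      by move=> a b; rewrite ffunE eqxx mul1r.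
    by rewrite mem_head; lia.
  have := linz j; rewrite inE (negPf jk) /= => lz.
  apply: lin_ext (lin_pull fst fst lz) => a b.
  by rewrite ffunE (negPf jk) mul0r addr0.
Qed.

Lemma state_tlayer m N (U : Op (Q n) (Q n)) (S : {set 'I_n}) :
  @state na nb m N U -> @state na nb (m + n * N) (4 * N + 4) (mulop (tlayer S) U).
Proof.
move=> [al [be [lam [x [z [impF linxz]]]]]].
have impT := impl_comp impF (gadget_local al be (tlayer_unitary S)).
rewrite addn0 in impT.
have le_m : (m + size (enum S) * N <= m + n * N)%N.
  by rewrite leq_add2l leq_mul2r -cardE -[X in (_ <= X)%N](card_ord n) max_card orbT.
suff [al' [be' [lam' [x' [z' [imp' lin']]]]]] :
    @state na nb (m + size (enum S) * N) (4 * N + 4) (mulop (tlayer S) U).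
  by exists al', be', lam', x', z'; split=> //; apply: impl_leq imp'.
apply: (@phases_cancel N (4 * N + 4) (mulop (tlayer S) U) (enum S) (leqnn _)
  (enum_uniq _) (al * unit)%type (be * unit)%type m
  (* The powers of the inverse of [omega8] produced by [tlayer_shift] involve only the X error, so
     they go into the scalar. *)
  (fun a b => lam a.1 b.1 * \prod_(k in S) omega8^-1 ^+ x a.1 b.1 k)
  (fun a b => x a.1 b.1) (fun a b => z a.1 b.1)).
- apply: impl_ext impT => -[a []] [b []] d ia ib; rewrite /paulied /=.
  have TE (I : finType) (V : Op I (Q n)) j i :
      mulop (@tlayer n S) V j i = (\prod_(k in S) omega8 ^+ j k) * V j i :> algC.
    rewrite /mulop -(sum_delta j (fun t => \prod_(k in S) omega8 ^+ t k * V t i)).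
    by apply: eq_bigr => t _; rewrite tlayerE [j == t]eq_sym mulrA.
  rewrite TE -[RHS]/(mulop (@tlayer n S) (fun d (_ : unit) => lam a b * (sg (dot (z a b) d) *
     U (qadd d (x a b)) (qjoin ia ib))) d tt) TE.
  by rewrite (tlayer_shift S (x a b) d); ring.
- by move=> k; have [lx _] := linxz k; exact: (lin_pull _ _ lx).
- move=> k; have [_ lz] := linxz k; apply: lin_leq (lin_pull fst fst lz).
  by case: ifP => _ //; lia.
Qed.

End TLayer.

(** * From amplitudes to channels *)

Definition sandwich (I J : finType) (K : Op I J) (rho : Op I I) : Op J J :=
  mulop (mulop K rho) (adj K).

Lemma sandwich_scale (I J : finType) (s : algC) (K V : Op I J) rho j j' :
  (forall j i, K j i = s * V j i) ->
  sandwich K rho j j' = s * s^* * sandwich V rho j j'.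
Proof.
move=> KE; rewrite /sandwich /mulop mulr_sumr; apply: eq_bigr => i _.
rewrite /adj KE conjcM (_ : \sum_k _ = s * \sum_k V j k * rho k i); first by ring.
by rewrite mulr_sumr; apply: eq_bigr => k _; rewrite KE mulrA.
Qed.

Lemma sandwich_ext (I J : finType) (K V : Op I J) rho j j' :
  (forall j i, K j i = V j i) -> sandwich K rho j j' = sandwich V rho j j'.
Proof.
move=> KE; rewrite (@sandwich_scale _ _ 1 K V) => [|l i]; last by rewrite mul1r.
by rewrite conjC1 !mul1r.
Qed.

Lemma sandwich_comp (I J L : finType) (X : Op J L) (K : Op I J) rho l l' :
  sandwich X (sandwich K rho) l l' = sandwich (mulop X K) rho l l'.
Proof.
have adjM j i : adj (mulop X K) j i = mulop (adj K) (adj X) j i.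
  rewrite /adj /mulop rmorph_sum; apply: eq_bigr => k _.
  by rewrite rmorphM mulrC.
rewrite /sandwich (eq_mulop (fun _ _ => erefl) adjM) -[RHS]mulopA.
apply: eq_mulop => // {}l j; rewrite -[LHS]mulopA.
by apply: eq_mulop => // {}l i; rewrite -mulopA.
Qed.

Lemma sandwich_sum (I J T : finType) (K : Op I J) (X : T -> Op I I) Y j j' :
  (forall i i', Y i i' = \sum_t X t i i') ->
  sandwich K Y j j' = \sum_t sandwich K (X t) j j'.
Proof.
move=> YE; rewrite /sandwich /mulop exchange_big; apply: eq_bigr => i _ /=.
rewrite -mulr_suml; congr (_ * _); rewrite exchange_big; apply: eq_bigr => k _ /=.
by rewrite YE mulr_sumr.
Qed.

Lemma apply2_sandwich (I I1 J1 I2 J2 T : finType) (Phi : channel I1 J1)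
    (Phi' : channel I2 J2) X (K : T -> Op I (I1 * I2)%type) rho j j' :
  (forall p p', X p p' = \sum_t sandwich (K t) rho p p') ->
  apply2 Phi Phi' X j j' = \sum_t \sum_k \sum_k'
    sandwich (mulop (tens_op (kop (c := Phi) k) (kop (c := Phi') k')) (K t)) rho j j'.
Proof.
move=> XE; rewrite [RHS]exchange_big; apply: eq_bigr => k _ /=.
rewrite [RHS]exchange_big; apply: eq_bigr => k' _ /=.
transitivity (\sum_t sandwich (tens_op (kop (c := Phi) k) (kop (c := Phi') k'))
   (sandwich (K t) rho) j j'); first exact: sandwich_sum.
by apply: eq_bigr => t _; rewrite sandwich_comp.
Qed.

Definition kraus (A B : finType) (m : nat) (Ka Ma Mb Kb : finType)
    (v : Op (A * Q m)%type (Ka * Mb)%type) (v' : Op (Q m * B)%type (Ma * Kb)%type)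
    (w : Op (Ka * Ma)%type A) (w' : Op (Mb * Kb)%type B) : Op (A * B)%type (A * B)%type :=
  fun j i => \sum_p w j.1 p.1 * w' j.2 p.2 *
    ((\sum_q v (p.1.1, p.2.1) (i.1, q) * v' (p.1.2, p.2.2) (q, i.2)) / sqrtC (2 ^ m)%:R).

(** The EPR state is pure, so adjoining it is a single Kraus operator [v0]. Composing it with the
    four channels gives one operator [kraus] for each choice of the four Kraus indices. *)
Lemma nlqc_map_kraus (A B : finType) (m : nat) (Ka Ma Mb Kb : finType)
    (V : channel (A * Q m)%type (Ka * Mb)%type)
    (V' : channel (Q m * B)%type (Ma * Kb)%type)
    (W : channel (Ka * Ma)%type A) (W' : channel (Mb * Kb)%type B) rho j j' :
  nlqc_map V V' W W' rho j j' =
  \sum_(t : (kidx V * kidx V')%type) \sum_k \sum_k'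
    sandwich (kraus (kop (c := V) t.1) (kop (c := V') t.2)
                    (kop (c := W) k) (kop (c := W') k')) rho j j'.
Proof.
pose v0 (s : ((A * Q m) * (Q m * B))%type) (i : (A * B)%type) : algC :=
  (s.1.1 == i.1)%:R * (s.2.2 == i.2)%:R * (s.1.2 == s.2.1)%:R / sqrtC (2 ^ m)%:R.
pose K (t : (kidx V * kidx V')%type) : Op (A * B)%type ((Ka * Ma) * (Mb * Kb))%type :=
  fun p i => mulop (tens_op (kop (c := V) t.1) (kop (c := V') t.2)) v0
    ((p.1.1, p.2.1), (p.1.2, p.2.2)) i.
have conj_r : ((sqrtC (2 ^ m)%:R)^-1 : algC)^* = (sqrtC (2 ^ m)%:R)^-1.
  by apply/CrealP; rewrite rpredV ger0_real // sqrtC_ge0 ler0n.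
have v0E s (F : A * B -> algC) : \sum_i v0 s i * F i =
    (s.1.2 == s.2.1)%:R / sqrtC (2 ^ m)%:R * F (s.1.1, s.2.2).
  rewrite -(sum_delta (s.1.1, s.2.2) (fun i => _ / _ * F i)).
  apply: eq_bigr => -[i1 i2] _; rewrite /v0 -pair_eqE /=.
  by rewrite [i1 == _]eq_sym [i2 == _]eq_sym -mulnb natrM -!mulrA.
rewrite /nlqc_map (apply2_sandwich W W' (K := K) (rho := rho)) => [|p p'].
  apply: eq_bigr => t _; apply: eq_bigr => k _; apply: eq_bigr => k' _.
  apply: sandwich_ext => l i; apply: eq_bigr => p _; congr (_ * _).
  rewrite /K /mulop /tens_op /v0 sum_prod sum_prod mulr_suml /=.
  rewrite exchange_big; apply: eq_bigr => q _ /=.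
  rewrite -(sum_delta i.1 (fun x => kop t.1 (p.1.1, p.2.1) (x, q) * _ / _)).
  apply: eq_bigr => x _; rewrite sum_prod /= exchange_big.
  rewrite -(sum_delta i.2 (fun y => (x == i.1)%:R *
    (kop t.1 (p.1.1, p.2.1) (x, q) * kop t.2 (p.1.2, p.2.2) (q, y) / sqrtC (2 ^ m)%:R))).
  apply: eq_bigr => y _.
  rewrite -(sum_delta q (fun q' => (y == i.2)%:R * ((x == i.1)%:R *
    (kop t.1 (p.1.1, p.2.1) (x, q) * kop t.2 (p.1.2, p.2.2) (q', y) / sqrtC (2 ^ m)%:R)))).
  apply: eq_bigr => q' _; rewrite [q == q']eq_sym; ring.
rewrite /Defs.reindex (apply2_sandwich V V' (T := unit) (K := fun=> v0) (rho := rho)).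
  by rewrite sum_unit sum_prod.
move=> s s'; rewrite sum_unit /sandwich /mulop /tens_op /epr /=.
under eq_bigr => i' _ do
  rewrite v0E mulrC /adj /v0 !conjcM !conjC_nat conj_r -/(v0 s' i').
rewrite v0E -[in LHS](sqrtCK (2 ^ m)%:R) expr2 invfM; ring.
Qed.

Lemma sum_qjoin (V : nmodType) na nb (F : Q (na + nb) -> V) :
  \sum_xa \sum_xb F (qjoin xa xb) = \sum_d F d.
Proof.
rewrite -(sum_prod (fun t => F (qjoin t.1 t.2))).
rewrite [RHS](reindex (fun t : Q na * Q nb => qjoin t.1 t.2)) //=.
exists (fun d => ([ffun k => d (lshift nb k)], [ffun k => d (rshift na k)])).
  move=> [xa xb] _; congr pair; apply/ffunP => k; rewrite !ffunE.
    by rewrite (unsplitK (inl _ k)).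
  by rewrite (unsplitK (inr _ k)).
move=> d _; apply/ffunP => k; rewrite ffunE -[k in RHS]splitK.
by case: (split k) => i /=; rewrite ffunE.
Qed.

(** * The local channels of the final protocol *)

Section Implementation.
Variables na nb : nat.
Let n := (na + nb)%N.

(** Relabelling both halves of the entangled state by the same bijection preserves it, so its labels
    may be taken to be bit strings. *)
Lemma impl_epr (A B D al be : finType) m (F : al -> be -> D -> A -> B -> algC) :
  impl m F -> exists m' (l : al * D -> A * Q m' -> algC) (r : be -> Q m' * B -> algC),
    [/\ (m' <= m)%N, isometric l, isometric r &
      forall a b d x y, F a b d x y = \sum_e l (a, d) (x, e) * r b (e, y)].
Proof.
move=> [E [m' [l [r [le_m cE isol isor FE]]]]].
have cQ : #|Q m'| = #|E| by rewrite card_ffun card_bool card_ord cE.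
have [g gbij] : exists g : Q m' -> E, bijective g.
  exists (fun e => enum_val (cast_ord cQ (enum_rank e))).
  exists (fun e => enum_val (cast_ord (esym cQ) (enum_rank e))) => e.
    by rewrite enum_valK cast_ordK enum_rankK.
  by rewrite enum_valK cast_ordKV enum_rankK.
have ginj := bij_inj gbij.
exists m', (fun t s => l t (s.1, g s.2)), (fun b s => r b (g s.1, s.2)).
split=> //.
- by move=> [x e] [x' e']; rewrite isol -!pair_eqE /= (inj_eq ginj).
- by move=> [e y] [e' y']; rewrite isor -!pair_eqE /= (inj_eq ginj).
- move=> a b d x y; rewrite FE (reindex g) //; exact: onW_bij.
Qed.

(** This is X^x Z^z, the inverse of the error Z^z X^x in [paulied]. *)
Definition pauli_decode k (x z : Q k) (j i : Q k) : algC :=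
  (i == qadd j x)%:R * sg (dot z i).

Lemma sum_pauli_decode k (x z i i' : Q k) :
  \sum_j (pauli_decode x z j i)^* * pauli_decode x z j i' = (i == i')%:R.
Proof.
transitivity (\sum_j (j == qadd i x)%:R * ((qadd j x == i')%:R : algC)).
  apply: eq_bigr => j _; rewrite /pauli_decode conjcM conjC_nat conj_sg eq_qadd.
  case: (j =P qadd i x) => [->|_]; last by rewrite !mul0r.
  rewrite qaddK [i' == _]eq_sym; case: (i =P i') => [<-|_]; last by rewrite mul0r !mulr0.
  by rewrite !mul1r sgK.
by rewrite sum_delta qaddK.
Qed.

Section Channels.
Variables (A B al be : finType) (m : nat).
Variables (l : al * Q n -> A * Q m -> algC) (r : be -> Q m * B -> algC).
Hypotheses (isol : isometric l) (isor : isometric r).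

(** The outcome is copied classically, once for each party; Alice keeps her part of the register and
    sends Bob's part to him. *)
Definition kopV (a : al) : Op (A * Q m)%type ((al * Q na) * (al * Q nb))%type :=
  fun y s => (y.1.1 == a)%:R * ((y.2.1 == a)%:R * l (a, qjoin y.1.2 y.2.2) s).

Lemma kopV_tp i i' : \sum_a mulop (adj (kopV a)) (kopV a) i i' = @idop _ i i'.
Proof.
rewrite /idop -isol sum_prod; apply: eq_bigr => a _.
rewrite -(sum_qjoin (fun d => (l (a, d) i)^* * l (a, d) i')).
pose G xa xb := (l (a, qjoin xa xb) i)^* * l (a, qjoin xa xb) i'.
rewrite -/(\sum_xa \sum_xb G xa xb) -(sum_delta a (fun=> \sum_xa \sum_xb G xa xb)).
rewrite /mulop sum_prod sum_prod.
apply: eq_bigr => a1 _; rewrite mulr_sumr; apply: eq_bigr => xa _ /=.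
rewrite sum_prod -(sum_delta a (fun=> (a1 == a)%:R * \sum_xb G xa xb)).
apply: eq_bigr => a2 _; rewrite !mulr_sumr; apply: eq_bigr => xb _ /=.
rewrite /adj /kopV /= !conjcM !conjC_nat.
by case: (a1 =P a) => _; case: (a2 =P a) => _; rewrite ?mul1r ?mul0r ?mulr0.
Qed.

Definition chV := Channel kopV_tp.

Definition kopV' (b : be) : Op (Q m * B)%type (be * be)%type :=
  fun y s => (y.1 == b)%:R * ((y.2 == b)%:R * r b s).

Lemma kopV'_tp i i' : \sum_b mulop (adj (kopV' b)) (kopV' b) i i' = @idop _ i i'.
Proof.
rewrite /idop -isor; apply: eq_bigr => b _.
rewrite -(sum_delta b (fun _ => (r b i)^* * r b i')) /mulop sum_prod.
apply: eq_bigr => b1 _.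
rewrite -(sum_delta b (fun=> (b1 == b)%:R * ((r b i)^* * r b i'))).
apply: eq_bigr => b2 _; rewrite /adj /kopV' /= !conjcM !conjC_nat.
by case: (b1 =P b) => _; case: (b2 =P b) => _; rewrite ?mul1r ?mul0r ?mulr0.
Qed.

Definition chV' := Channel kopV'_tp.


End Channels.

Definition lpart (d : Q n) : Q na := [ffun k => d (lshift nb k)].
Definition rpart (d : Q n) : Q nb := [ffun k => d (rshift na k)].

Section Decoder.
Variables (al be : finType) (k : nat) (x z : al -> be -> Q k).

(** One decoder serves both parties, since after the exchange each has its part of the register and
    both outcomes. The Kraus index [t] reads off the outcome pair. *)
Definition kopW (t : al * be) : Op ((al * Q k) * be)%type (Q k) :=
  fun j y => (y.1.1 == t.1)%:R * ((y.2 == t.2)%:R *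
    pauli_decode (x t.1 t.2) (z t.1 t.2) j y.1.2).

Lemma kopW_tp i i' : \sum_t mulop (adj (kopW t)) (kopW t) i i' = @idop _ i i'.
Proof.
case: i i' => [[a q] b] [[a' q'] b']; rewrite /idop -!pair_eqE /= -!pair_eqE /=.
transitivity (\sum_t (t == (a, b))%:R * ((t == (a', b'))%:R * (q == q')%:R : algC)).
  apply: eq_bigr => -[a1 b1] _.
  rewrite -(sum_pauli_decode (x a1 b1) (z a1 b1) q q') !mulr_sumr.
  apply: eq_bigr => j _.
  rewrite /adj /kopW /= !conjcM !conjC_nat -!pair_eqE /= -!mulnb !natrM.
  by rewrite ![a1 == _]eq_sym ![b1 == _]eq_sym; ring.
rewrite sum_delta -pair_eqE /= -!mulnb !natrM; ring.
Qed.

Definition chW := Channel kopW_tp.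
End Decoder.
End Implementation.

(** The two isometries leave one unit for each label of [E]; the total is not 1 because amplitudes
    omit the normalisation of the entangled state. *)
Lemma amplitude_norm (A B D E al be : finType) (l : al * D -> A * E -> algC)
    (r : be -> E * B -> algC) x y :
  isometric l -> isometric r ->
  \sum_a \sum_b \sum_d (\sum_e l (a, d) (x, e) * r b (e, y))^* *
     (\sum_e l (a, d) (x, e) * r b (e, y)) = #|E|%:R.
Proof.
move=> isol isor.
transitivity (\sum_t \sum_b \sum_e \sum_e' ((l t (x, e))^* * l t (x, e')) *
   ((r b (e, y))^* * r b (e', y))).
  rewrite sum_prod; apply: eq_bigr => a _; rewrite exchange_big.
  apply: eq_bigr => d _; apply: eq_bigr => b _.
  rewrite rmorph_sum mulr_suml; apply: eq_bigr => e _ /=.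
  rewrite mulr_sumr; apply: eq_bigr => e' _; rewrite rmorphM; ring.
transitivity (\sum_e \sum_e' (\sum_t (l t (x, e))^* * l t (x, e')) *
   (\sum_b (r b (e, y))^* * r b (e', y))).
  under eq_bigr => t _ do rewrite exchange_big.
  rewrite exchange_big; apply: eq_bigr => e _ /=.
  under eq_bigr => t _ do rewrite exchange_big.
  rewrite exchange_big; apply: eq_bigr => e' _ /=.
  by rewrite mulr_suml; apply: eq_bigr => t _; rewrite mulr_sumr.
transitivity (\sum_(e : E) (1 : algC)); last by rewrite sumr_const.
apply: eq_bigr => e _.
rewrite -[RHS](sum_delta e (fun=> 1)); apply: eq_bigr => e' _.
rewrite isol isor -!pair_eqE /= !eqxx /= andbT [e == e']eq_sym.
by case: (e' == e); rewrite /= ?mulr1 ?mulr0.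
Qed.

Section Implementation.
Variables na nb : nat.
Let n := (na + nb)%N.

Lemma qjoin_parts (d : Q n) : qjoin (lpart d) (rpart d) = d.
Proof.
apply/ffunP => k; rewrite ffunE -[k in RHS]splitK.
by case: (split k) => i /=; rewrite ffunE.
Qed.

(** Both decoders must read the outcomes [t] that occurred; then a single intermediate label
    contributes and the Pauli error cancels. So every Kraus operator is zero or a multiple of
    [split_op U]. *)
Lemma kraus_decoded (al be : finType) m (U : Op (Q n) (Q n)) lam (x z : al -> be -> Q n)
   (l : al * Q n -> Q na * Q m -> algC) (r : be -> Q m * Q nb -> algC) :
  (forall a b d xa xb, paulied U lam x z a b d xa xb =
     \sum_e l (a, d) (xa, e) * r b (e, xb)) ->
  forall t w w' j i,
  kraus (kopV l t.1) (kopV' r t.2)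
     (kopW (fun a b => lpart (x a b)) (fun a b => lpart (z a b)) w)
     (kopW (fun a b => rpart (x a b)) (fun a b => rpart (z a b)) w') j i =
  (w == t)%:R * ((w' == t)%:R * (lam t.1 t.2 / sqrtC (2 ^ m)%:R)) * split_op U j i.
Proof.
move=> FE [a b] w w' j i /=.
pose p0 : ((al * Q na) * be) * ((al * Q nb) * be) :=
  (((w.1, qadd j.1 (lpart (x w.1 w.2))), w.2),
   ((w'.1, qadd j.2 (rpart (x w'.1 w'.2))), w'.2)).
pose G (p : ((al * Q na) * be) * ((al * Q nb) * be)) : algC :=
  sg (dot (lpart (z w.1 w.2)) p.1.1.2) * sg (dot (rpart (z w'.1 w'.2)) p.2.1.2) *
  ((p.1.1.1 == a)%:R * (p.2.1.1 == a)%:R * (p.1.2 == b)%:R * (p.2.2 == b)%:R *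
  paulied U lam x z a b (qjoin p.1.1.2 p.2.1.2) i.1 i.2 / sqrtC (2 ^ m)%:R).
transitivity (\sum_p (p == p0)%:R * G p).
  apply: eq_bigr => -[[[a1 xa] b1] [[a2 xb] b2]] _.
  rewrite /G /p0 -!pair_eqE /= -!pair_eqE /= -!pair_eqE /= -!mulnb !natrM FE.
  rewrite /kopW /pauli_decode /kopV /kopV' /=.
  rewrite (_ : \sum_q _ = (a1 == a)%:R * (a2 == a)%:R * (b1 == b)%:R * (b2 == b)%:R *
    \sum_e l (a, qjoin xa xb) (i.1, e) * r b (e, i.2)); first by ring.
  by rewrite mulr_sumr; apply: eq_bigr => e _; ring.
rewrite sum_delta /G /p0 /=.
case: w w' {p0 G} => [a1 b1] [a2 b2] /=; rewrite -!pair_eqE /= -!mulnb !natrM.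
case: (a1 =P a) => [->|_]; last by rewrite !(mul0r, mulr0).
case: (a2 =P a) => [->|_]; last by rewrite !(mul0r, mulr0).
case: (b1 =P b) => [->|_]; last by rewrite !(mul0r, mulr0).
case: (b2 =P b) => [->|_]; last by rewrite !(mul0r, mulr0).
rewrite !mul1r /paulied /split_op.
set d := qjoin (qadd j.1 _) _.
have -> : qadd d (x a b) = qjoin j.1 j.2.
  by rewrite -[x a b]qjoin_parts qadd_qjoin !qaddK.
have -> : dot (z a b) d = dot (lpart (z a b)) (qadd j.1 (lpart (x a b))) +
    dot (rpart (z a b)) (qadd j.2 (rpart (x a b))).
  by rewrite -{1}[z a b]qjoin_parts dot_qjoin.
rewrite sgD; set s := sg _; set s' := sg _.
have ss : s * s' * (s * s') = 1 by rewrite mulrACA !sgK mulr1.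
by rewrite -[RHS]mul1r -ss; ring.
Qed.

Lemma state_implements m N (U : Op (Q n) (Q n)) : isometric U -> @state na nb m N U ->
  exists m', (m' <= m)%N /\ nlqc_implements (split_op U) m'.
Proof.
move=> isoU [al [be [lam [x [z [/impl_epr[m' [l [r [le_m isol isor FE]]]] _]]]]]].
exists m'; split=> //.
exists (al * Q na)%type, be, (al * Q nb)%type, be, (chV isol), (chV' isor),
  (chW (fun a b => lpart (x a b)) (fun a b => lpart (z a b))),
  (chW (fun a b => rpart (x a b)) (fun a b => rpart (z a b))) => rho j j'.
rewrite nlqc_map_kraus /=.
pose mu t : algC := lam t.1 t.2 / sqrtC (2 ^ m')%:R.
(* The weights of all outcome pairs add up to 1: the norm identity is applied to the all-zero input,
   whose column in [U] has norm 1. *)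
have norm_mu : \sum_t mu t * (mu t)^* = 1.
  have p0 : (2 ^ m')%:R != 0 :> algC by rewrite pnatr_eq0 expn_eq0.
  have rr : (sqrtC (2 ^ m')%:R)^-1 * ((sqrtC (2 ^ m')%:R)^-1)^* = (2 ^ m')%:R^-1 :> algC.
    by rewrite -normCK normfV ger0_norm ?sqrtC_ge0 ?ler0n // exprVn sqrtCK.
  have := amplitude_norm (q0 na) (q0 nb) isol isor.
  rewrite card_ffun card_bool card_ord => normF.
  apply: (mulfI p0); rewrite mulr1 -[RHS]normF sum_prod mulr_sumr.
  apply: eq_bigr => a _; rewrite mulr_sumr; apply: eq_bigr => b _.
  under [RHS]eq_bigr => d _ do rewrite -FE /paulied 2!conjcM conj_sg mulrACA
    [sg _ * _ * _]mulrACA sgK mul1r.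
  rewrite -[RHS]mulr_sumr (sum_qadd (x a b)).
  under [in RHS]eq_bigr => d _ do rewrite qaddK.
  rewrite isoU eqxx mulr1 /mu /= conjcM mulrACA.
  by rewrite rr mulrCA mulfV // mulr1 mulrC.
rewrite -[RHS]mul1r -norm_mu mulr_suml; apply: eq_bigr => t _.
rewrite -(sum_delta t (fun=> mu t * (mu t)^* *
   mulop (mulop (split_op U) rho) (adj (split_op U)) j j')).
apply: eq_bigr => w _.
rewrite -(sum_delta t (fun=> (w == t)%:R * (mu t * (mu t)^* *
   mulop (mulop (split_op U) rho) (adj (split_op U)) j j'))).
apply: eq_bigr => w' _.
rewrite (sandwich_scale _ _ _ (kraus_decoded FE t w w')) !conjcM !conjC_nat.
rewrite -/(mu t) /sandwich.
by case: (w == t); case: (w' == t); rewrite /= ?mul1r ?mul0r ?mulr0 ?mul0r.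
Qed.

End Implementation.

(** * Assembling the circuit and counting rows and EPR pairs *)

Lemma isometric_mulop (I : finType) (X Y : Op I I) :
  isometric X -> isometric Y -> isometric (mulop X Y).
Proof.
move=> isoX isoY i i'; rewrite -isoY.
transitivity (\sum_j \sum_k (Y j i)^* * Y k i' * \sum_t (X t j)^* * X t k).
  rewrite /mulop; under eq_bigr => t _ do rewrite rmorph_sum mulr_suml.
  rewrite exchange_big; apply: eq_bigr => j _ /=.
  under eq_bigr => t _ do rewrite mulr_sumr.
  rewrite exchange_big; apply: eq_bigr => k _ /=.
  by rewrite mulr_sumr; apply: eq_bigr => t _; rewrite rmorphM; ring.
apply: eq_bigr => j _; rewrite -(sum_delta j (fun k => (Y j i)^* * Y k i')).
by apply: eq_bigr => k _; rewrite isoX [j == k]eq_sym mulrC.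
Qed.

Lemma ct_prod_isometric n (Cs : nat -> Op (Q n) (Q n)) Ts d :
  (forall k, (k <= d)%N -> clifford (Cs k)) -> isometric (ct_prod Cs Ts d).
Proof.
have iso C : @clifford n C -> isometric C.
  by move=> [uC _] i i'; have [E _] := uC i i'; exact: E.
elim: d => [|d IHd] clC /=; first exact/iso/clC.
apply: isometric_mulop; last by apply: IHd => k le_kd; apply: clC; apply: leqW.
apply: isometric_mulop; last exact: tlayer_unitary.
exact/iso/clC.
Qed.

(** Both recursions combine the costs in [state_tlayer] and [state_clifford]; the initial values
    come from [state_start]. *)
Fixpoint row_count (n k : nat) : nat :=
  if k is k'.+1 then ((n + n) * (4 * row_count n k' + 4).+1).+1 else 2.
Fixpoint epr_count (n b k : nat) : nat :=
  if k is k'.+1 then epr_count n b k' + n * row_count n k' else b.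

Lemma state_ct_prod na nb (Cs : nat -> Op (Q (na + nb)) (Q (na + nb))) Ts d :
  (forall k, (k <= d)%N -> clifford (Cs k)) ->
  state (epr_count (na + nb) nb d) (row_count (na + nb) d) (ct_prod Cs Ts d).
Proof.
elim: d => [|d IHd] clC /=; first exact: state_start (clC 0%N _).
apply: (@state_ext _ _ _ _ (mulop (Cs d.+1) (mulop (tlayer (Ts d)) (ct_prod Cs Ts d)))).
  by move=> j i; rewrite mulopA.
apply: state_clifford; first exact: clC.
by apply: state_tlayer; apply: IHd => k le_kd; apply: clC; apply: leqW.
Qed.

(** One step sends r to 8nr + 10n + 1, which is at most 17nr because r is at least 2 and n at least
    1. *)
Lemma row_count_leq n k : (0 < n)%N -> (row_count n k <= 2 * (17 * n) ^ k)%N.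
Proof.
move=> n0; have row2 j : (1 < row_count n j)%N.
  by case: j => //= j; rewrite ltnS muln_gt0 addn_gt0 n0.
elim: k => [|k IHk] //=; rewrite expnS mulnCA.
have := row2 k; move: (row_count n k) ((17 * n) ^ k)%N IHk => r p le_r r2.
have : (17 * n * r <= 17 * n * (2 * p))%N by rewrite leq_mul2l le_r orbT.
nia.
Qed.

(** At depth 0 the count is [b] while the power is 1, so the induction starts at depth 1 with b + 2n
    pairs. A further layer adds at most 2n (17n)^d, which the new factor 17n absorbs. *)
Lemma epr_count_leq n b d : (b <= n)%N -> (0 < d)%N ->
  (epr_count n b d <= (17 * n) ^ d)%N.
Proof.
case: n => [|n] le_bn; case: d => // d _.
  (* Without qubits [b] vanishes too, and no pair is used. *)
  have -> k : epr_count 0 b k = 0%N.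
    by elim: k => [|k IHk] /=; [lia | rewrite IHk mul0n].
  by [].
elim: d => [|d IHd]; first by rewrite /= expn1; lia.
rewrite [epr_count _ _ _]/= -/(epr_count _ _ d.+1) -/(row_count _ d.+1).
have := @row_count_leq n.+1 d.+1 isT.
rewrite [((17 * n.+1) ^ d.+2)%N]expnS.
move: (row_count _ _) (epr_count _ _ _) ((17 * n.+1) ^ d.+1)%N IHd => r m p le_m le_r.
have : (n.+1 * r <= n.+1 * (2 * p))%N by rewrite leq_mul2l le_r orbT.
nia.
Qed.

Theorem mainTheorem1 :
  exists K C : algC, 0 < K /\
    forall (a b d : nat) (U : Op (Q (a + b)) (Q (a + b))),
      (0 < d)%N ->
      has_CT_decomp U d ->
      E_le (split_op U) (C * (K * (a + b)%:R) ^+ d).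
Proof.
(* The constant 17 is the growth factor per layer in the two counting bounds, which carry no
   prefactor for the pairs. *)
exists 17, 1; split=> // a b d U d_gt0 [Cs [Ts [clC UE]]].
have isoU : isometric U.
  move=> i i'; rewrite -(ct_prod_isometric Ts clC).
  by apply: eq_bigr => t _; rewrite !UE.
have stU := state_ext (fun j i => esym (UE j i)) (state_ct_prod Ts clC).
have [m [le_m impU]] := state_implements isoU stU.
exists m; split=> //.
rewrite mul1r -natrM -natrX ler_nat.
by apply: leq_trans le_m (epr_count_leq _ d_gt0); rewrite leq_addl.
Qed.
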